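(* Let $g\ge 2$. The groups $\tilde\Gamma_g$ and $\Gamma_g\times\mathbf{Z}$ admit an ME coupling which is in $L^p$ for all $0<p<1$.
   Context: $\Gamma_g$ is the fundamental group of the compact orientable surface of genus $g$, with presentation $\langle x_1,\dots,x_g,y_1,\dots,y_g \mid R\rangle$, where $R=[x_1,y_1]\cdots[x_g,y_g]$. $\tilde\Gamma_g$ is its canonical central extension, with presentation $\langle z,x_1,\dots,x_g,y_1,\dots,y_g \mid Rz^{-1},\ z \text{ is central}\rangle$. Let $\Gamma,\Lambda$ be finitely generated (discrete) groups, each equipped with a word length $|\cdot|$ for some finite generating set. A measure equivalence (ME) coupling between them is a nonzero $\sigma$-finite measure space $(X,\mu)$ with commuting $\mu$-preserving actions of $\Gamma$ and $\Lambda$, both of which have finite-measure fundamental domains $X_\Gamma$, $X_\Lambda$ respectively (a fundamental domain is a measurable set whose translates are pairwise disjoint and cover $X$, up to null sets). The fundamental domains are regarded as part of the data of the coupling. The associated cocycle $\alpha:\Gamma\times X_\Lambda\to\Lambda$ is defined by: $\alpha(\gamma,x)$ is the element of $\Lambda$ such that $\alpha(\gamma,x)\gamma x\in X_\Lambda$; the cocycle $\beta:\Lambda\times X_\Gamma\to\Gamma$ is defined symmetrically. The coupling is in $L^p$ if $\int_{X_\Lambda}|\alpha(\gamma,x)|^p\,d\mu(x)<\infty$ and $\int_{X_\Gamma}|\beta(\lambda,x')|^p\,d\mu(x')<\infty$ for all $\gamma\in\Gamma$, $\lambda\in\Lambda$. *)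

(* Defs.v *)
From HB Require Import structures.
From mathcomp Require Import all_boot all_order all_algebra generic_quotient.
From mathcomp Require Import all_classical all_reals all_analysis.

Set Implicit Arguments.
Unset Strict Implicit.
Unset Printing Implicit Defensive.

Import Order.TTheory GRing.Theory Num.Theory.
Local Open Scope classical_set_scope.
Local Open Scope ring_scope.

(* A word over the alphabet I^{+-1}: the letter (i, false) stands for the
   generator i and the letter (i, true) for its formal inverse. *)
Definition word (I : choiceType) : Type := seq (I * bool).

Definition letter_inv (I : choiceType) (a : I * bool) : I * bool :=
  (a.1, ~~ a.2).

Definition word_inv (I : choiceType) (w : word I) : word I :=
  rev (map (@letter_inv I) w).

(* The quotient of words by this congruence is the quotient of the free group
   on I by the normal closure of rels. *)
Inductive pres_eq (I : choiceType) (rels : set (word I)) :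
    word I -> word I -> Prop :=
| pres_eq_refl u : pres_eq rels u u
| pres_eq_sym u v : pres_eq rels u v -> pres_eq rels v u
| pres_eq_trans u v w :
    pres_eq rels u v -> pres_eq rels v w -> pres_eq rels u w
| pres_eq_cancel u a v :
    pres_eq rels (u ++ [:: a; letter_inv a] ++ v) (u ++ v)
| pres_eq_relator u r v : rels r -> pres_eq rels (u ++ r ++ v) (u ++ v).

Section PresentedGroup.
Local Open Scope quotient_scope.
Variables (I : choiceType) (rels : set (word I)).
Implicit Types u v w : word I.

Let letter_invK : involutive (@letter_inv I).
Proof. by case=> i b; rewrite /letter_inv /= negbK. Qed.

Lemma word_inv_cat u v : word_inv (u ++ v) = word_inv v ++ word_inv u.
Proof. by rewrite /word_inv map_cat rev_cat. Qed.

Lemma word_invK : involutive (@word_inv I).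
Proof. by move=> w; rewrite /word_inv map_rev revK mapK. Qed.

Lemma pres_eq_ctx s t u v :
  pres_eq rels u v -> pres_eq rels (s ++ u ++ t) (s ++ v ++ t).
Proof.
elim=> {u v} [u|u v _|u v w _ uv _|u a v|u r v rr].
- exact: pres_eq_refl.
- exact: pres_eq_sym.
- exact: pres_eq_trans.
- by have := pres_eq_cancel rels (s ++ u) a (v ++ t); rewrite -!catA.
- by have := pres_eq_relator (s ++ u) (v ++ t) rr; rewrite -!catA.
Qed.

Lemma pres_eq_cat u u' v v' :
  pres_eq rels u u' -> pres_eq rels v v' -> pres_eq rels (u ++ v) (u' ++ v').
Proof.
move=> uu' vv'; apply: (@pres_eq_trans _ _ _ (u' ++ v)).
  exact: (@pres_eq_ctx [::] v).
by have := pres_eq_ctx u' [::] vv'; rewrite !cats0.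
Qed.

Lemma pres_eq_mulwV u : pres_eq rels (u ++ word_inv u) [::].
Proof.
elim: u => [|a u IHu]; first exact: pres_eq_refl.
have -> : word_inv (a :: u) = word_inv u ++ [:: letter_inv a].
  by rewrite /word_inv /= rev_cons cats1.
apply: pres_eq_trans (pres_eq_cancel rels [::] a [::]).
by have := pres_eq_ctx [:: a] [:: letter_inv a] IHu; rewrite /= -!catA.
Qed.

Lemma pres_eq_mulVw u : pres_eq rels (word_inv u ++ u) [::].
Proof. by have := pres_eq_mulwV (word_inv u); rewrite word_invK. Qed.

Lemma pres_eq_inv u v :
  pres_eq rels u v -> pres_eq rels (word_inv u) (word_inv v).
Proof.
move=> uv; apply: (@pres_eq_trans _ _ _ (word_inv u ++ (v ++ word_inv v))).
  apply: pres_eq_sym; rewrite -[X in pres_eq _ _ X]cats0.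
  exact/pres_eq_cat/pres_eq_mulwV/pres_eq_refl.
apply: (@pres_eq_trans _ _ _ (word_inv u ++ (u ++ word_inv v))).
  by apply: pres_eq_ctx; exact: pres_eq_sym.
rewrite catA -[X in pres_eq _ _ X]cat0s.
exact/pres_eq_cat/pres_eq_refl/pres_eq_mulVw.
Qed.

Definition pres_rel : rel (word I) := fun u v => `[< pres_eq rels u v >].

Lemma pres_rel_refl : reflexive pres_rel.
Proof. by move=> u; apply/asboolP/pres_eq_refl. Qed.

Lemma pres_rel_sym : symmetric pres_rel.
Proof. by move=> u v; apply/asboolP/asboolP; exact: pres_eq_sym. Qed.

Lemma pres_rel_trans : transitive pres_rel.
Proof.
by move=> v u w /asboolP uv /asboolP vw; apply/asboolP/(pres_eq_trans uv).
Qed.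

Canonical pres_equiv : equiv_rel (word I) :=
  EquivRel pres_rel pres_rel_refl pres_rel_sym pres_rel_trans.

Definition presented_group : Type := {eq_quot pres_equiv}.

HB.instance Definition _ := Choice.on presented_group.
HB.instance Definition _ := EqQuotient.on presented_group.

Lemma pi_presP u v :
  (\pi_presented_group u = \pi_presented_group v) <-> pres_eq rels u v.
Proof.
split=> [/eqP|uv]; first by rewrite eqquotE => /asboolP.
by apply/eqP; rewrite eqquotE; apply/asboolP.
Qed.

Definition pres_one : presented_group := \pi_presented_group [::].
Definition pres_mul (a b : presented_group) : presented_group :=
  \pi_presented_group (repr a ++ repr b).
Definition pres_inv (a : presented_group) : presented_group :=
  \pi_presented_group (word_inv (repr a)).

Let repr_pi u : pres_eq rels (repr (\pi_presented_group u)) u.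
Proof. by apply/pi_presP; rewrite reprK. Qed.

Lemma pres_mulE u v :
  pres_mul (\pi_presented_group u) (\pi_presented_group v) =
  \pi_presented_group (u ++ v).
Proof. by apply/pi_presP/pres_eq_cat; exact: repr_pi. Qed.

Lemma pres_invE u : pres_inv (\pi_presented_group u) =
  \pi_presented_group (word_inv u).
Proof. by apply/pi_presP/pres_eq_inv; exact: repr_pi. Qed.

Lemma pres_mulA : associative pres_mul.
Proof.
move=> a b c; rewrite -[a]reprK -[b]reprK -[c]reprK.
move: (repr a) (repr b) (repr c) => u v w.
by rewrite (pres_mulE v w) (pres_mulE u) (pres_mulE u v) (pres_mulE _ w) catA.
Qed.

Lemma pres_mul1 : left_id pres_one pres_mul.
Proof. by move=> a; rewrite -[a]reprK pres_mulE. Qed.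

Lemma pres_mulr1 : right_id pres_one pres_mul.
Proof. by move=> a; rewrite -[a]reprK pres_mulE cats0. Qed.

Lemma pres_mulV : left_inverse pres_one pres_inv pres_mul.
Proof.
by move=> a; rewrite -[a]reprK pres_invE pres_mulE; apply/pi_presP/pres_eq_mulVw.
Qed.

Lemma pres_mulrV : right_inverse pres_one pres_inv pres_mul.
Proof.
by move=> a; rewrite -[a]reprK pres_invE pres_mulE; apply/pi_presP/pres_eq_mulwV.
Qed.

HB.instance Definition _ := isGroup.Build presented_group
  pres_mulA pres_mul1 pres_mulr1 pres_mulV pres_mulrV.

End PresentedGroup.

Definition commutator_word (I : choiceType) (a b : I) : word I :=
  [:: (a, false); (b, false); (a, true); (b, true)].

Definition surface_word (I : choiceType) (g : nat) (x y : 'I_g -> I) : word I :=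
  flatten [seq commutator_word (x i) (y i) | i <- enum 'I_g].

(* The generators x_i and y_i are inl i and inr i. *)
Definition surface_relators (g : nat) : set (word ('I_g + 'I_g)%type) :=
  [set surface_word inl inr].

Definition surface_group (g : nat) : groupType :=
  presented_group (@surface_relators g).

(* The generators x_i, y_i and z are Some (inl i), Some (inr i) and None.
   Centrality of z is the family of relators [z, s], s = x_i or y_i. *)
Definition surface_ext_relators (g : nat) :
    set (word (option ('I_g + 'I_g)%type)) :=
  [set surface_word (Some \o inl) (Some \o inr) ++ [:: (None, true)]]
  `|` [set commutator_word None (Some s) | s in [set: 'I_g + 'I_g]].

Definition surface_ext_group (g : nat) : groupType :=
  presented_group (@surface_ext_relators g).

Definition infinite_cyclic_group : groupType := Algebra.to_multiplicative int.

Section WordLength.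
Local Open Scope group_scope.
Variables (G : groupType) (S : set G).

Definition is_word_length_of (g : G) (n : nat) : Prop :=
  exists w : seq G,
    [/\ size w = n, {in w, forall s, S s \/ S s^-1} & \prod_(s <- w) s = g].

Definition finite_generating_set : Prop :=
  finite_set S /\ forall g : G, exists n, is_word_length_of g n.

(* The default value 0 is only used if S does not generate G. *)
Definition word_length (g : G) : nat :=
  xget 0%N [set n | is_word_length_of g n /\
                    forall m, is_word_length_of g m -> (n <= m)%N].

End WordLength.

Definition is_group_action (G : groupType) (T : Type) (a : G -> T -> T) : Prop :=
  (forall x, a 1%g x = x) /\ (forall g h x, a (g * h)%g x = a g (a h x)).

Section MeasuredActions.
Context (d : measure_display) (T : measurableType d) (R : realType).
Variables (mu : {measure set T -> \bar R}) (G : groupType) (a : G -> T -> T).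

Definition measure_preserving_action : Prop :=
  [/\ is_group_action a,
      forall g, measurable_fun setT (a g) &
      forall g A, measurable A -> mu (a g @^-1` A) = mu A].

Definition fundamental_domain (D : set T) : Prop :=
  [/\ measurable D,
      forall g h, g <> h -> mu.-negligible ((a g @` D) `&` (a h @` D)) &
      mu.-negligible (~` \bigcup_(g in [set: G]) (a g @` D))].

End MeasuredActions.

(* For almost every x there is exactly one l in L with l (g x) in D, when D is
   a fundamental domain of L; elsewhere the value is an arbitrary choice, which
   does not affect the integrals below. *)
Definition coupling_cocycle (T : Type) (G L : groupType)
    (aG : G -> T -> T) (aL : L -> T -> T) (D : set T) (g : G) (x : T) : L :=
  xget 1%g [set l | D (aL l (aG g x))].

Record ME_coupling (R : realType) (G L : groupType) := MECoupling {
  me_display : measure_display;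
  me_space : measurableType me_display;
  me_measure : {measure set me_space -> \bar R};
  me_actl : G -> me_space -> me_space;
  me_actr : L -> me_space -> me_space;
  me_doml : set me_space;
  me_domr : set me_space;
  me_sigma_finite : sigma_finite setT me_measure;
  me_nonzero : me_measure setT <> 0%E;
  me_actlP : measure_preserving_action me_measure me_actl;
  me_actrP : measure_preserving_action me_measure me_actr;
  me_commute : forall g l x,
    me_actl g (me_actr l x) = me_actr l (me_actl g x);
  me_domlP : fundamental_domain me_measure me_actl me_doml;
  me_domrP : fundamental_domain me_measure me_actr me_domr;
  me_doml_fin : (me_measure me_doml < +oo)%E;
  me_domr_fin : (me_measure me_domr < +oo)%E }.

Arguments me_actl {R G L} m.
Arguments me_actr {R G L} m.
Arguments me_doml {R G L} m.
Arguments me_domr {R G L} m.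

Definition me_alpha (R : realType) (G L : groupType) (X : ME_coupling R G L) :
    G -> me_space X -> L :=
  coupling_cocycle (me_actl X) (me_actr X) (me_domr X).

Definition me_beta (R : realType) (G L : groupType) (X : ME_coupling R G L) :
    L -> me_space X -> G :=
  coupling_cocycle (me_actr X) (me_actl X) (me_doml X).

Arguments me_alpha {R G L} X.
Arguments me_beta {R G L} X.

Definition in_Lp (R : realType) (G L : groupType) (SG : set G) (SL : set L)
    (X : ME_coupling R G L) (p : R) : Prop :=
  (forall g : G, (\int[me_measure X]_(x in me_domr X)
     ((word_length SL (me_alpha X g x))%:R `^ p)%:E < +oo)%E) /\
  (forall l : L, (\int[me_measure X]_(x in me_doml X)
     ((word_length SG (me_beta X l x))%:R `^ p)%:E < +oo)%E).

(* Main.v *)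
(** The central extension is trivialised by a measurable integer cocycle, i.e.
    by an action of the extension on the line, commuting with integer
    translations and sending the central generator to [t |-> t + 1], whose
    displacement is in weak [L^1]. Together with left translation on the surface
    group this gives an action on (line) x (surface group), which commutes with
    the action of the product group by integer translations on the line and
    right translations; [(0,1] x {1}] is a fundamental domain of both.

    The action on the line comes from writing [1 = (a o phi - a) + (a o psi - a)]
    on [(0,1]], where [phi] and [psi] are measure-preserving bijections and [a] is
    integer-valued: [a = 2^k - 1] on [(2^-(k+1), 2^-k]], and [phi], [psi] each
    move one half of every such interval onto the next one and the other half into
    [(1/2, 1]]. Each term of the sum is the displacement of the commutator of an
    exchange with the shear [t |-> t + a(t)]. Since [a(t) < 1 / t], the tail of [a]
    is that of a weak [L^1] function, and the latter are in [L^p] for [p < 1]. *)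
Require Import Defs.
From HB Require Import structures.
From mathcomp Require Import all_boot all_order all_algebra.
From mathcomp Require Import all_classical all_reals all_analysis.
From mathcomp Require Import measurable_realfun.
From mathcomp Require Import ring lra zify.

Import Order.TTheory GRing.Theory Num.Theory.
Local Open Scope ring_scope.

Set Implicit Arguments.
Unset Strict Implicit.
Unset Printing Implicit Defensive.

(** * Dyadic intervals and the exchanges on [(0, 1]] *)

Section DyadicExchange.
Context {R : realType}.
Implicit Types (r x y d : R) (b : bool) (k : nat).

(* For [0 < r <= 1] this is the power [d] of 1/2 such that [d / 2 < r <= d]. *)
Definition dyadic_ceil r : R :=
  if r <= 0 then 0 else 2 ^- trunc_log 2 (Num.truncn r^-1).

Lemma dyadic_ceil_eq k r : 2 ^- k / 2 < r <= 2 ^- k -> dyadic_ceil r = 2 ^- k.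
Proof.
have p0 : 0 < 2 ^- k :> R by rewrite invr_gt0 exprn_gt0.
move=> /andP[lo hi]; have r0 : 0 < r.
  by apply: le_lt_trans lo; rewrite divr_ge0 // ltW.
rewrite /dyadic_ceil leNgt r0 /=; congr (_ ^- _).
apply: trunc_log_eq => //.
rewrite truncn_ge_nat ?invr_ge0 ?(ltW r0)// truncn_lt_nat ?invr_ge0 ?(ltW r0)//.
rewrite !natrX; apply/andP; split.
  by rewrite -[leLHS]invrK lef_pV2 ?posrE.
by rewrite -[ltRHS]invrK ltf_pV2 ?posrE ?invr_gt0 ?exprn_gt0// exprSr invfM.
Qed.

Lemma dyadic_ceilP r : 0 < r <= 1 ->
  exists2 k, dyadic_ceil r = 2 ^- k & 2 ^- k / 2 < r <= 2 ^- k.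
Proof.
move=> /andP[r0 r1]; rewrite /dyadic_ceil leNgt r0 /=.
set m := Num.truncn _; exists (trunc_log 2 m) => //.
have rV : 1 <= r^-1 by rewrite invf_ge1.
have m0 : (0 < m)%N by rewrite truncn_gt0.
have /andP[] := trunc_log_bounds (isT : (1 < 2)%N) m0.
rewrite truncn_ge_nat ?invr_ge0 ?(ltW r0)// truncn_lt_nat ?invr_ge0 ?(ltW r0)//.
rewrite !natrX => lo hi; apply/andP; split.
  by rewrite -invfM -exprSr -[ltRHS]invrK ltf_pV2 ?posrE ?invr_gt0 ?exprn_gt0.
by rewrite -[leLHS]invrK lef_pV2 ?posrE ?invr_gt0 ?exprn_gt0.
Qed.

Lemma dyadic_ceil_itv r : 0 < r <= 1 ->
  dyadic_ceil r / 2 < r <= dyadic_ceil r /\ dyadic_ceil r <= 1.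
Proof.
move=> /dyadic_ceilP[k -> ?]; split=> //.
by rewrite invf_le1 ?exprn_gt0// exprn_ege1 // ler1n.
Qed.

Lemma dyadic_ceil1 r : 1 / 2 < r <= 1 -> dyadic_ceil r = 1.
Proof.
by move=> h; rewrite (@dyadic_ceil_eq 0) expr0 invr1.
Qed.

Lemma dyadic_ceil_half r y : 0 < r <= 1 ->
  dyadic_ceil r / 4 < y <= dyadic_ceil r / 2 ->
  dyadic_ceil y = dyadic_ceil r / 2.
Proof.
move=> /dyadic_ceilP[k -> _] h; rewrite (@dyadic_ceil_eq k.+1) ?exprSr ?invfM//.
by move: h; set d := _ ^- k; lra.
Qed.

Lemma dyadic_ceil_double r y : 0 < r <= 1 / 2 ->
  dyadic_ceil r < y <= dyadic_ceil r * 2 ->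
  dyadic_ceil y = dyadic_ceil r * 2 /\ dyadic_ceil r * 2 <= 1.
Proof.
move=> r0; have [k -> lohi] : exists2 k, dyadic_ceil r = 2 ^- k
    & 2 ^- k / 2 < r <= 2 ^- k by apply: dyadic_ceilP; lra.
case: k lohi => [|k]; first by rewrite expr0 invr1; lra.
move=> lohi; have -> : 2 ^- k.+1 * 2 = 2 ^- k :> R.
  by rewrite exprSr invfM -mulrA mulVf ?mulr1.
move=> h; split; first by apply: dyadic_ceil_eq; move: h; rewrite exprSr invfM.
by rewrite invf_le1 ?exprn_gt0// exprn_ege1 // ler1n.
Qed.

(** Monotonicity yields Borel measurability on the whole line; the value 0 on nonpositive numbers
    keeps it valid across the origin. *)
Lemma le_dyadic_ceil : {homo dyadic_ceil : x y / x <= y}.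
Proof.
move=> x y xy; rewrite /dyadic_ceil.
have [x0|x0] := leP x 0.
  by case: ifP => // _; rewrite invr_ge0 exprn_ge0.
have y0 : 0 < y by exact: lt_le_trans xy.
rewrite (leNgt y) y0 /= lef_pV2 ?posrE ?exprn_gt0// ler_weXn2l ?ler1n//.
by apply/leq_trunc_log/le_truncn; rewrite lef_pV2.
Qed.

Lemma dyadic_ceil_rat r : exists q : rat, dyadic_ceil r = ratr q.
Proof.
rewrite /dyadic_ceil; case: ifP => _; first by exists 0; rewrite rmorph0.
set k := trunc_log _ _; exists (2 ^- k).
by rewrite fmorphV rmorphXn /= ratr_nat.
Qed.

(** With [d = dyadic_ceil r], the dyadic interval of [r] is [(d / 2, d]], whose midpoint is
    [3 d / 4]. *)
Definition upper r : bool := dyadic_ceil r * (3 / 4) < r.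

(* On (2^-(k+1), 2^-k] the half selected by [b] (the upper one if [b = true]) is
   moved onto (2^-(k+2), 2^-(k+1)], and the other half is moved into (1/2, 1]. *)
Definition exch b r : R :=
  r - (if upper r then dyadic_ceil r / 2 else dyadic_ceil r / 4)
  + (if upper r == b then 0 else 1 / 2).

(** The flag [v] detects a jump into [(1/2, 1]], and [v != b] recovers the half that the point came
    from. Once the jump is undone, [y'] lies one dyadic level below its origin, so the possible
    translation lengths [d / 2] and [d / 4] are [dyadic_ceil y'] and half of it. *)
Definition exch_inv b y : R :=
  let v := 1 / 2 < y in let y' := y - (if v then 1 / 2 else 0) in
  y' + (if v != b then dyadic_ceil y' else dyadic_ceil y' / 2).

(** The upper half of [(d / 2, d]] lowered by [d / 2] and the lower half lowered by [d / 4] both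
    become [(d / 4, d / 2]]. This is the common first stage of the two exchanges, before the jump by
    1/2. *)
Lemma exch_cases r : 0 < r <= 1 ->
  let d := dyadic_ceil r in
  let y' := r - (if upper r then d / 2 else d / 4) in
  d / 4 < y' <= d / 2 /\ 0 < y' <= 1 / 2.
Proof.
move=> r0 /=; have [h d1] := dyadic_ceil_itv r0.
by rewrite /upper; case: (ltP (dyadic_ceil r * (3 / 4)) r) => ?; split; lra.
Qed.

Lemma exch_itv b r : 0 < r <= 1 -> 0 < exch b r <= 1.
Proof.
move=> r0; have /= [] := exch_cases r0; rewrite /exch.
by case: (_ == _) => /= *; lra.
Qed.

Lemma exch_inv_itv b y : 0 < y <= 1 -> 0 < exch_inv b y <= 1.
Proof.
move=> y0; rewrite /exch_inv.
case: (ltP (1 / 2) y) => h; set y' := y - _.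
  have y'0 : 0 < y' <= 1 / 2 by rewrite /y'; lra.
  have [|? ?] := @dyadic_ceil_itv y'; first lra.
  have [|? ?] := @dyadic_ceil_double y' (dyadic_ceil y' * 2) y'0; first lra.
  by case: (_ != _) => /=; lra.
have y'0 : 0 < y' <= 1 / 2 by rewrite /y'; lra.
have [|? ?] := @dyadic_ceil_itv y'; first lra.
have [|? ?] := @dyadic_ceil_double y' (dyadic_ceil y' * 2) y'0; first lra.
by case: (_ != _) => /=; lra.
Qed.

Lemma exchK b r : 0 < r <= 1 -> exch_inv b (exch b r) = r.
Proof.
move=> r0; have /= [h1 h2] := exch_cases r0.
rewrite /exch_inv; have -> : (1 / 2 < exch b r) = (upper r != b).
  by rewrite /exch; case: (_ == _); apply/idP/idP => //=; lra.
have -> : exch b r - (if upper r != b then 1 / 2 else 0) =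
    r - (if upper r then dyadic_ceil r / 2 else dyadic_ceil r / 4).
  by rewrite /exch; case: (_ == _) => /=; rewrite ?addrK ?addr0 ?subr0.
rewrite (dyadic_ceil_half r0 h1).
have -> : ((upper r != b) != b) = upper r by case: (upper r) b => [] [].
by case: (upper r) => /=; lra.
Qed.

Lemma exch_invK b y : 0 < y <= 1 -> exch b (exch_inv b y) = y.
Proof.
move=> y0; rewrite /exch_inv.
set v := 1 / 2 < y; set y' := y - _.
have y'0 : 0 < y' <= 1 / 2 by rewrite /y' /v; case: (ltP (1 / 2) y) => /=; lra.
have [|h1 h2] := @dyadic_ceil_itv y'; first lra.
set r := y' + _.
have h : dyadic_ceil y' < r <= dyadic_ceil y' * 2.
  by rewrite /r; case: (_ != _) => /=; lra.
have [dr d1] := dyadic_ceil_double y'0 h.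
have ur : upper r = (v != b).
  by rewrite /upper dr /r; case: (_ != _); apply/idP/idP => //=; lra.
rewrite /exch ur dr.
have -> : ((v != b) == b) = ~~ v by case: (v); case: (b).
rewrite /r /y'; case: (v != b); case: (v) => /=; lra.
Qed.

Definition height r : R := (dyadic_ceil r)^-1 - 1.

(** Put [e = 1 / dyadic_ceil r]. Exactly one of the exchanges selects the half that contains [r]; it
    takes the height to [2 e - 1], and the other one takes it to 0. The sum is
    [(2 e - 1) - 2 (e - 1) = 1]. *)
Lemma height_exch r : 0 < r <= 1 ->
  height (exch true r) - height r + (height (exch false r) - height r) = 1.
Proof.
move=> r0; have [lohi _] := dyadic_ceil_itv r0.
have E b : height (exch b r) =
    if upper r == b then (dyadic_ceil r)^-1 * 2 - 1 else 0.
  have /= [h1 h2] := exch_cases r0; rewrite /exch /height.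
  case: (_ == _) => /=; first by rewrite addr0 (dyadic_ceil_half r0 h1) invfM invrK.
  by rewrite dyadic_ceil1 ?invr1 ?subrr//; lra.
rewrite !E /height; set e := _^-1.
by case: (upper r) => /=; lra.
Qed.

Lemma height_int r : 0 < r <= 1 -> exists n : int, height r = n%:~R.
Proof.
move=> /dyadic_ceilP[k dk _]; exists ((2 ^ k)%N%:Z - 1).
by rewrite /height dk invrK intrB -pmulrn natrX.
Qed.

Lemma height_ge0 r : 0 < r <= 1 -> 0 <= height r.
Proof.
move=> r0; have [h1 h2] := dyadic_ceil_itv r0.
by rewrite /height subr_ge0 invf_ge1//; lra.
Qed.

Lemma height_lt r : 0 < r <= 1 -> height r < r^-1.
Proof.
move=> r0; have [h1 h2] := dyadic_ceil_itv r0.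
rewrite /height (@lt_le_trans _ _ (dyadic_ceil r)^-1)// ?ltrBlDr ?ltrDl//.
by rewrite lef_pV2 ?posrE; lra.
Qed.

End DyadicExchange.

(** * Integer parts and periodic extension of maps *)

Section IntegerPart.
Context {R : realType}.
Implicit Types (x y r : R) (f : R -> R) (m : int).

(** The ceiling is used because the cells are [(m, m + 1]], in accordance with the domain [(0, 1]]:
    an integer is the right end point of its cell. *)
Definition lint x : int := Num.ceil x - 1.
Definition rfrac x : R := x - (lint x)%:~R.
Definition unit_itv : set R := [set` `]0, 1]%R].

Lemma unit_itvE x : unit_itv x = (0 < x <= 1) :> Prop.
Proof. by rewrite /unit_itv /= in_itv. Qed.

Lemma rfrac_itv x : 0 < rfrac x <= 1.
Proof.
rewrite /rfrac /lint; have := ceil_itv x.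
by rewrite intrB; lra.
Qed.

Lemma lintE m x : (m%:~R < x <= m%:~R + 1) = (lint x == m).
Proof.
rewrite /lint subr_eq ceil_eq addrK.
by rewrite intrD.
Qed.

Lemma lintDr x m : lint (x + m%:~R) = lint x + m.
Proof.
apply/eqP; rewrite -lintE intrD.
have := rfrac_itv x; rewrite /rfrac; lra.
Qed.

Lemma rfracDr x m : rfrac (x + m%:~R) = rfrac x.
Proof. by rewrite /rfrac lintDr intrD; lra. Qed.

Lemma lint_unit r : 0 < r <= 1 -> lint r = 0.
Proof. by move=> r0; apply/eqP; rewrite -lintE; lra. Qed.

Lemma rfrac_unit r : 0 < r <= 1 -> rfrac r = r.
Proof. by move=> r0; rewrite /rfrac lint_unit// subr0. Qed.

Definition periodize f x : R := (lint x)%:~R + f (rfrac x).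

Lemma periodizeDr f x m : periodize f (x + m%:~R) = periodize f x + m%:~R.
Proof. by rewrite /periodize lintDr rfracDr intrD; lra. Qed.

Lemma periodizeK f g : (forall r, 0 < r <= 1 -> 0 < f r <= 1) ->
  (forall r, 0 < r <= 1 -> g (f r) = r) -> cancel (periodize f) (periodize g).
Proof.
move=> fI fK x; have rI := rfrac_itv x; have frI := fI _ rI.
rewrite [periodize f x]/periodize (addrC (lint x)%:~R) periodizeDr /periodize.
rewrite lint_unit// rfrac_unit// fK// /rfrac; lra.
Qed.

Lemma rfrac_periodize f x : (forall r, 0 < r <= 1 -> 0 < f r <= 1) ->
  rfrac (periodize f x) = f (rfrac x).
Proof.
move=> fI; rewrite /periodize (addrC (lint x)%:~R) rfracDr rfrac_unit//.
exact/fI/rfrac_itv.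
Qed.

End IntegerPart.

(** * Piecewise translations preserve Lebesgue measure *)

Section PiecewiseTranslation.
Context {R : realType}.
Local Open Scope classical_set_scope.
Implicit Types (x c : R) (f g : R -> R) (A E : set R) (m : int).
Notation lambda := (@lebesgue_measure R).

Lemma lebesgue_measure_translation c A : measurable A ->
  lambda ((fun x => x + c) @^-1` A) = lambda A.
Proof.
move=> mA; rewrite -[LHS]/(pushforward lambda
  (fun x => x + c : measurableTypeR R) A).
apply/esym/lebesgue_measure_unique => [|mc _ [[a b]] _ <-|//].
  by apply: measurable_funD => //; exact: measurable_cst.
rewrite /= /pushforward.
have -> : (fun x => x + c) @^-1` `]a, b] = `]a - c, b - c].
  by apply/seteqP; split=> x /=; rewrite !in_itv /=; lra.
rewrite !lebesgue_measure_itv/= !lte_fin ltrD2r; case: ifP => // _.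
by rewrite !EFinB; congr EFin; lra.
Qed.

(* Rationality is only there to have countably many translation lengths. *)
Definition piecewise_translation f : Prop :=
  [/\ measurable_fun setT f,
      forall x m, f (x + m%:~R) = f x + m%:~R &
      forall x, exists q : rat, f x - x = ratr q].

Lemma piecewise_translation_comp f g : piecewise_translation f ->
  piecewise_translation g -> piecewise_translation (f \o g).
Proof.
move=> [mf fD fq] [mg gD gq]; split=> [|x m|x] /=.
- exact: measurableT_comp.
- by rewrite gD fD.
- have [q qE] := fq (g x); have [q' q'E] := gq x.
  by exists (q + q'); rewrite rmorphD /= -qE -q'E; lra.
Qed.

(** The displacements are rational, so the line splits into countably many measurable pieces on each
    of which [f] is a single translation. The pieces of the preimage of [A] correspond to the pieces
    of [A] cut out by the displacement of the inverse, and translation invariance equates their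
    measures one by one. *)
Lemma piecewise_translation_preserves f g : piecewise_translation f ->
  piecewise_translation g -> cancel f g -> cancel g f ->
  forall A, measurable A -> lambda (f @^-1` A) = lambda A.
Proof.
move=> [mf _ fq] [mg _ gq] fK gK A mA.
(* Pieces are indexed by codes of rationals and are empty at a non-code. Each rational has a single
   code for [pickle_inv], so the pieces are disjoint. *)
pose P (h : R -> R) (n : nat) : set R :=
  [set x | exists2 q : rat, pickle_inv n = Some q & h x = ratr q].
have mP (h : R -> R) n : measurable_fun setT h -> measurable (P h n).
  move=> mh; rewrite /P; case: (pickle_inv n) => [q|]; last first.
    by rewrite (_ : mkset _ = set0)//; apply/seteqP; split=> x // [].
  rewrite (_ : mkset _ = h @^-1` [set ratr q]).
    by rewrite -[_ @^-1` _]setTI; exact: mh.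
  by apply/seteqP; split=> [x [_ [<-] //]|x /= hx]; exists q.
have tP (h : R -> R) : trivIset setT (P h).
  move=> i j _ _ [x [[q qi hq] [q' qj hq']]].
  have /eqP := etrans (esym hq) hq'; rewrite (inj_eq (fmorph_inj _)) => /eqP qq.
  have := @pickle_invK rat i; have := @pickle_invK rat j.
  by rewrite qi qj qq /=; move=> <- <-.
(* The sign of [v] is chosen so that [v (f x) = u x]. *)
pose u x := f x - x; pose v y := y - g y.
have mu' : measurable_fun setT u by exact: measurable_funB.
have mv : measurable_fun setT v by exact: measurable_funB.
have uE : f @^-1` A = \bigcup_n (f @^-1` A `&` P u n).
  apply/seteqP; split=> [x Ax|x [n _ []]//]; have [q qE] := fq x.
  by exists (pickle q) => //; split => //; exists q => //; rewrite pickleK_inv.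
have vE : A = \bigcup_n (A `&` P v n).
  apply/seteqP; split=> [x Ax|x [n _ []]//]; have [q qE] := gq x.
  exists (pickle (- q)) => //; split => //; exists (- q) => //.
    by rewrite pickleK_inv.
  by rewrite rmorphN /= -qE /v opprB.
have mfA : measurable (f @^-1` A) by rewrite -[_ @^-1` _]setTI; exact: mf.
have sum h B : measurable_fun setT h -> measurable B ->
    lambda (\bigcup_n (B `&` P h n)) =
    (\sum_(0 <= n <oo | n \in [set: nat]) lambda (B `&` P h n))%E.
  move=> mh mB; apply: measure_bigcup => [n _|]; last exact/trivIset_setIl/tP.
  by apply: measurableI => //; exact: mP.
rewrite uE [in RHS]vE !sum//.
apply: eq_eseriesr => n _.
have [[q qn]|qn] := pselect (exists q : rat, pickle_inv n = Some q); last first.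
  suff P0 h : P h n = set0 by rewrite !P0 !setI0.
  by apply/seteqP; split=> x // [q ? _]; case: qn; exists q.
rewrite -(@lebesgue_measure_translation (ratr q) (A `&` P v n)); last first.
  by apply: measurableI => //; exact: mP.
congr (lambda _); apply/seteqP; split=> x /=.
  move=> [Afx [q' q'n uxq]]; move: q'n; rewrite qn => -[?]; subst q'.
  have <- : f x = x + ratr q by rewrite -uxq /u; lra.
  by split=> //; exists q => //; rewrite /v fK -uxq.
move=> [Afx [q' q'n vxq]]; move: q'n; rewrite qn => -[?]; subst q'.
have gx : g (x + ratr q) = x by move: vxq; rewrite /v; lra.
have fx : f x = x + ratr q by rewrite -gx gK gx.
by rewrite fx; split => //; exists q => //; rewrite /u fx; lra.
Qed.

End PiecewiseTranslation.

(** * Exchanges and shears of the line, and their commutators *)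

Section ExchangeMaps.
Context {R : realType}.
Implicit Types (x r : R) (b : bool) (m : int).

Lemma measurable_dyadic_ceil : measurable_fun setT (@dyadic_ceil R).
Proof. by apply: nondecreasing_measurable => //; exact: le_dyadic_ceil. Qed.

Lemma dyadic_ceil_ge0 r : 0 <= dyadic_ceil r.
Proof. by rewrite /dyadic_ceil; case: ifP => // _; rewrite invr_ge0 exprn_ge0. Qed.

Lemma measurable_lint : measurable_fun setT (fun x : R => (lint x)%:~R : R).
Proof.
apply: nondecreasing_measurable => // x y xy; rewrite ler_int.
by rewrite /lint lerD2r; exact: ceil_le.
Qed.

Lemma measurable_rfrac : measurable_fun setT (@rfrac R).
Proof. by apply: measurable_funB => //; exact: measurable_lint. Qed.

Lemma measurable_periodize (f : R -> R) :
  measurable_fun setT f -> measurable_fun setT (periodize f).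
Proof.
move=> mf; apply: measurable_funD; first exact: measurable_lint.
exact: measurableT_comp mf measurable_rfrac.
Qed.

Lemma measurable_exch b : measurable_fun setT (@exch R b).
Proof.
have md (c : R) : measurable_fun setT (fun r : R => dyadic_ceil r * c).
  by apply: measurable_funM => //; exact: measurable_dyadic_ceil.
have mu : measurable_fun setT (@upper R).
  by apply: measurable_fun_ltr => //; exact: md.
rewrite (_ : exch b = fun r => r
    - (if upper r then dyadic_ceil r / 2 else dyadic_ceil r / 4)
    + (if upper r then if b then 0 else 1 / 2 else if b then 1 / 2 else 0)).
  apply: measurable_funD; last by apply: measurable_fun_ifT.
  by apply: measurable_funB => //; apply: measurable_fun_ifT => //; exact: md.
by apply/funext => r; rewrite /exch; case: (upper r) b => [] [].
Qed.

Lemma measurable_exch_inv b : measurable_fun setT (@exch_inv R b).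
Proof.
have mv : measurable_fun setT (fun y : R => 1 / 2 < y).
  exact: measurable_fun_ltr.
have my : measurable_fun setT (fun y : R => y - (if 1 / 2 < y then 1 / 2 else 0)).
  by apply: measurable_funB => //; exact: measurable_fun_ifT.
have md : measurable_fun setT
    (fun y : R => dyadic_ceil (y - (if 1 / 2 < y then 1 / 2 else 0))).
  exact: measurableT_comp measurable_dyadic_ceil my.
have md2 : measurable_fun setT
    (fun y : R => dyadic_ceil (y - (if 1 / 2 < y then 1 / 2 else 0)) / 2).
  by apply: measurable_funM => //; exact: measurable_cst.
rewrite (_ : exch_inv b = fun y =>
  let y' := y - (if 1 / 2 < y then 1 / 2 else 0) in
  y' + (if 1 / 2 < y then if b then dyadic_ceil y' / 2 else dyadic_ceil y'
        else if b then dyadic_ceil y' else dyadic_ceil y' / 2)).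
  by apply: measurable_funD => //; apply: measurable_fun_ifT => //; case: b.
by apply/funext => y; rewrite /exch_inv; case: (1 / 2 < y) b => [] [].
Qed.

Definition rational_real x : Prop := exists q : rat, x = ratr q.

Lemma rational_realD x y :
  rational_real x -> rational_real y -> rational_real (x + y).
Proof. by move=> [q ->] [q' ->]; exists (q + q'); rewrite rmorphD. Qed.

Lemma rational_realM x y :
  rational_real x -> rational_real y -> rational_real (x * y).
Proof. by move=> [q ->] [q' ->]; exists (q * q'); rewrite rmorphM. Qed.

Lemma rational_realN x : rational_real x -> rational_real (- x).
Proof. by move=> [q ->]; exists (- q); rewrite rmorphN. Qed.

Lemma rational_real_int m : rational_real m%:~R.
Proof. by exists m%:~R; rewrite ratr_int. Qed.

Lemma rational_real_dyadic r k : rational_real (dyadic_ceil r / k%:R).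
Proof.
apply: rational_realM; first exact: dyadic_ceil_rat.
by exists k%:R^-1; rewrite fmorphV /= ratr_nat.
Qed.

Lemma piecewise_translation_periodize (f : R -> R) : measurable_fun setT f ->
  (forall r, rational_real (f r - r)) ->
  piecewise_translation (periodize f).
Proof.
move=> mf fq; split=> [|x m|x]; first exact: measurable_periodize.
  exact: periodizeDr.
have [q qE] := fq (rfrac x); exists q; rewrite -qE /periodize /rfrac; lra.
Qed.

Lemma rational_real_if (c : bool) x y :
  rational_real x -> rational_real y -> rational_real (if c then x else y).
Proof. by case: c. Qed.

Lemma rational_real_half : rational_real (1 / 2 : R).
Proof. by exists (1 / 2); rewrite fmorph_div /= rmorph1 ratr_nat. Qed.

Lemma piecewise_translation_exch b : piecewise_translation (periodize (@exch R b)).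
Proof.
apply: piecewise_translation_periodize (measurable_exch b) _ => r.
rewrite /exch addrAC (addrAC r) subrr sub0r.
have r0 : rational_real (0 : R) by exact: (rational_real_int 0).
apply: rational_realD; last exact: rational_real_if rational_real_half.
by apply/rational_realN/rational_real_if; exact: rational_real_dyadic.
Qed.

Lemma piecewise_translation_exch_inv b :
  piecewise_translation (periodize (@exch_inv R b)).
Proof.
apply: piecewise_translation_periodize (measurable_exch_inv b) _ => y.
have r0 : rational_real (0 : R) by exact: (rational_real_int 0).
rewrite /exch_inv addrAC (addrAC y) subrr sub0r.
apply: rational_realD.
  by apply/rational_realN/rational_real_if => //; exact: rational_real_half.
apply: rational_real_if; last exact: rational_real_dyadic.
by rewrite -[dyadic_ceil _]divr1; exact: (rational_real_dyadic _ 1).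
Qed.

Definition shear m x : R := x + m%:~R * height (rfrac x).

Lemma shear_shift m x : exists k : int, shear m x = x + k%:~R.
Proof.
have [n hn] := height_int (rfrac_itv x).
by exists (m * n); rewrite /shear hn intrM.
Qed.

Lemma rfrac_shear m x : rfrac (shear m x) = rfrac x.
Proof. by have [k ->] := shear_shift m x; rewrite rfracDr. Qed.

Lemma shearK m : cancel (shear m) (shear (- m)).
Proof.
by move=> x; rewrite {1}/shear rfrac_shear /shear intrN mulNr addrK.
Qed.

Lemma piecewise_translation_shear m : piecewise_translation (shear m).
Proof.
split=> [|x k|x].
- apply: measurable_funD => //; apply: measurable_funM => //.
  apply: measurableT_comp measurable_rfrac.
  apply: measurable_funB => //.
  rewrite (_ : (fun _ => _) = fun r : R => dyadic_ceil r `^ (-1)).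
    exact: measurableT_comp (measurable_powR _) measurable_dyadic_ceil.
  by apply/funext => r; rewrite powR_inv1 ?dyadic_ceil_ge0.
- by rewrite /shear rfracDr; lra.
- have [k ->] := shear_shift m x.
  by rewrite addrAC subrr add0r; exact: rational_real_int.
Qed.

(** The first shear subtracts the integer height of the fractional part [r], which passes through
    the exchange because the latter commutes with integer translations. The second shear adds the
    integer height of the exchanged [r], which passes through the inverse exchange, and the two
    exchanges cancel. *)
Lemma commutator_exch_shear b x :
  periodize (exch_inv b) (shear 1 (periodize (exch b) (shear (-1) x))) =
  x + (height (exch b (rfrac x)) - height (rfrac x)).
Proof.
have r0 := rfrac_itv x; have [n hn] := height_int r0.
have [k hk] := height_int (exch_itv b r0).
rewrite {2}/shear hn.
rewrite (_ : _ + _ * _ = x + (- n)%:~R); last by rewrite intrN; lra.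
rewrite periodizeDr /shear rfracDr rfrac_periodize; last exact: exch_itv.
rewrite hk mul1r -addrA -intrD periodizeDr periodizeK ?hk ?hn//.
- by rewrite intrD intrN; lra.
- exact: exch_itv.
- exact: exchK.
Qed.

End ExchangeMaps.

(** * Weak integrability of displacements over the unit interval *)

Section WeakIntegrability.
Context {R : realType}.
Local Open Scope classical_set_scope.
Implicit Types (x r : R) (f g : R -> R) (A E : set R) (m : int) (b : bool).
Notation lambda := (@lebesgue_measure R).
Notation I := (@unit_itv R).

Definition periodic_set E : Prop := forall x m, E x -> E (x + m%:~R).

(** Testing on periodic sets makes [(0, 1]] stand for the circle: a shear moves points out of
    [(0, 1]] but preserves measure modulo 1. *)
Definition unit_preserving f : Prop := forall E, measurable E ->
  periodic_set E -> lambda (I `&` f @^-1` E) = lambda (I `&` E).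

Definition weakly_integrable_shift f : Prop := exists C : R, forall r : R,
  0 < r -> (lambda (I `&` [set x | (r <= `|f x - x|)%R]) <= (C / r)%:E)%E.

Lemma measurable_unit_itv : measurable I.
Proof. exact: measurable_itv. Qed.

Lemma lebesgue_unit_itv : lambda I = 1%E.
Proof. by rewrite lebesgue_measure_itv/= lte_fin ltr01 oppr0 adde0. Qed.

Lemma measurable_shift_ge f r : measurable_fun setT f ->
  measurable [set x | (r <= `|f x - x|)%R].
Proof.
move=> mf; have mfr : measurable_fun setT (fun x => `|f x - x|).
  by apply: measurableT_comp => //; exact: measurable_funB.
rewrite (_ : mkset _ = (fun x => `|f x - x|) @^-1` `[r, +oo[).
  by rewrite -[_ @^-1` _]setTI; apply: mfr => //; exact: measurable_itv.
by apply/seteqP; split=> x /=; rewrite in_itv /= andbT.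
Qed.

(** Under the periodized bijection [(0, 1]] is its own preimage, so this is preservation of Lebesgue
    measure applied to the intersection with [E]. *)
Lemma unit_preserving_periodize f g :
  piecewise_translation (periodize f) -> piecewise_translation (periodize g) ->
  (forall r, 0 < r <= 1 -> 0 < f r <= 1) ->
  (forall r, 0 < r <= 1 -> 0 < g r <= 1) ->
  (forall r, 0 < r <= 1 -> g (f r) = r) ->
  (forall r, 0 < r <= 1 -> f (g r) = r) ->
  unit_preserving (periodize f).
Proof.
move=> pf pg fI gI fK gK E mE _.
rewrite -[RHS](piecewise_translation_preserves pf pg); first last.
- by apply: measurableI => //; exact: measurable_unit_itv.
- exact: periodizeK.
- exact: periodizeK.
rewrite preimage_setI; congr (lambda (_ `&` _)).
apply/seteqP; split=> x /=; rewrite !unit_itvE => hx.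
  by rewrite /periodize lint_unit// add0r rfrac_unit//; exact: fI.
have -> : x = periodize g (periodize f x) by rewrite periodizeK.
by rewrite {1 3}/periodize lint_unit// add0r rfrac_unit//; exact: gI.
Qed.

(** Such a map is the identity modulo 1, so a periodic set is its own preimage. *)
Lemma unit_preserving_shift f :
  (forall x, exists k : int, f x = x + k%:~R) -> unit_preserving f.
Proof.
move=> fk E _ pE; congr (lambda (_ `&` _)); apply/seteqP; split=> x /= Ex.
  have [k fx] := fk x; have -> : x = f x + (- k)%:~R by rewrite fx intrN addrK.
  exact: pE.
by have [k ->] := fk x; exact: pE.
Qed.

Lemma periodic_preimage f E : piecewise_translation f -> periodic_set E ->
  periodic_set (f @^-1` E).
Proof. by move=> [_ fD _] pE x m; rewrite /preimage /= fD; exact: pE. Qed.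

Lemma unit_preserving_comp f g : piecewise_translation f ->
  unit_preserving f -> unit_preserving g -> unit_preserving (f \o g).
Proof.
move=> pf uf ug E mE pE; rewrite comp_preimage ug ?uf//.
  by have [mf _ _] := pf; rewrite -[_ @^-1` _]setTI; exact: mf.
exact: periodic_preimage.
Qed.

(** If the displacement of the composite is at least [r], then that of [g] at [x] or that of [f] at
    [g x] is at least [r / 2], whence the doubled constants. The second condition is a periodic one
    on [g x], and [g] preserves the measure of periodic sets. *)
Lemma weakly_integrable_shift_comp f g : piecewise_translation f ->
  piecewise_translation g -> unit_preserving g ->
  weakly_integrable_shift f -> weakly_integrable_shift g ->
  weakly_integrable_shift (f \o g).
Proof.
move=> pf pg ug [C hC] [D hD]; exists (C * 2 + D * 2) => r r0.
have [mf fD _] := pf; have [mg _ _] := pg.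
pose E s h : set R := [set x | (s <= `|h x - x|)%R].
have r20 : 0 < r / 2 by rewrite divr_gt0.
have mE h : measurable_fun setT h -> measurable (E (r / 2) h).
  exact: measurable_shift_ge.
have mgE : measurable (g @^-1` E (r / 2) f).
  by rewrite -[_ @^-1` _]setTI; apply: mg => //; exact: mE.
apply: (@le_trans _ _
    (lambda ((I `&` g @^-1` E (r / 2) f) `|` (I `&` E (r / 2) g)))).
  apply: le_measure; rewrite ?inE.
  - apply: measurableI; first exact: measurable_unit_itv.
    by apply: measurable_shift_ge; exact: measurableT_comp.
  - by apply: measurableU; apply: measurableI => //;
      [exact: measurable_unit_itv|exact: measurable_unit_itv|exact: mE].
  - move=> x [Ix /= h].
    have [h1|h1] := leP (r / 2) `|f (g x) - g x|; [by left|right].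
    split=> //; rewrite /E /=.
    have := ler_normD (f (g x) - g x) (g x - x); rewrite addrA subrK; lra.
apply: le_trans (measureU2 _ _ _) _.
- by apply: measurableI => //; exact: measurable_unit_itv.
- by apply: measurableI; [exact: measurable_unit_itv|exact: mE].
have -> : (C * 2 + D * 2) / r = C / (r / 2) + D / (r / 2).
  by rewrite !invfM invrK -mulrDl; field; rewrite gt_eqF.
rewrite EFinD; apply: leeD; last exact: hD.
have pE : periodic_set (E (r / 2) f).
  by move=> x m; rewrite /E /= fD opprD addrACA subrr addr0.
by have := hC _ r20; rewrite -(ug _ (mE f mf) pE).
Qed.

Lemma weakly_integrable_shift_bounded f :
  (forall x, 0 < x <= 1 -> `|f x - x| <= 1) -> measurable_fun setT f ->
  weakly_integrable_shift f.
Proof.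
move=> fb mf; exists 1 => r r0.
have [r1|r1] := leP r 1.
  apply: (@le_trans _ _ (lambda I)).
    apply: le_measure; rewrite ?inE //; last exact: measurable_unit_itv.
    by apply: measurableI; [exact: measurable_unit_itv|exact: measurable_shift_ge].
  by rewrite lebesgue_unit_itv lee_fin div1r invf_ge1.
rewrite (_ : _ `&` _ = set0) ?measure0 ?lee_fin ?divr_ge0 ?ltW//.
apply/seteqP; split=> x // [/=]; rewrite unit_itvE => /fb; lra.
Qed.

Lemma weakly_integrable_shear m : `|m|%N = 1%N ->
  weakly_integrable_shift (@shear R m).
Proof.
move=> m1; exists 1 => r r0.
apply: (@le_trans _ _ (lambda `]0, r^-1[)); last first.
  rewrite lebesgue_measure_itv/= lte_fin invr_gt0 r0 div1r.
  by rewrite oppr0 adde0.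
apply: le_measure; rewrite ?inE //.
  apply: measurableI; first exact: measurable_unit_itv.
  by apply: measurable_shift_ge; have [] := @piecewise_translation_shear R m.
move=> x [/=]; rewrite unit_itvE => x0 h; rewrite in_itv /=.
have /andP[x1 _] := x0; rewrite x1 /= -[x]invrK ltf_pV2 ?posrE ?invr_gt0//.
apply: le_lt_trans (height_lt x0); apply: le_trans h _.
rewrite /shear addrAC subrr add0r normrM rfrac_unit// (ger0_norm (height_ge0 x0)).
have -> : `|m%:~R : R| = 1 by rewrite -intr_norm -abszE m1.
by rewrite mul1r.
Qed.

End WeakIntegrability.

(** * Actions of a group given by generators and relators *)

Section PresentedGroupAction.
Local Open Scope quotient_scope.
Context (I : choiceType) (rels : set (word I)).
Implicit Types (u v w : word I) (a : I * bool).
Notation G := (presented_group rels).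

Lemma pres_pi_cat u v :
  \pi_G (u ++ v) = (\pi_G u * \pi_G v)%g.
Proof. by rewrite -[RHS]/(pres_mul _ _) pres_mulE. Qed.

Lemma pres_pi_nil : \pi_G [::] = 1%g.
Proof. by []. Qed.

Lemma pres_pi_invl i : \pi_G [:: (i, true)] = (\pi_G [:: (i, false)])^-1%g.
Proof. by rewrite -[RHS]/(pres_inv _) pres_invE. Qed.

Context (T : Type) (act : I * bool -> T -> T).
Hypothesis actK : forall a, cancel (act (letter_inv a)) (act a).
Hypothesis act_rels : forall r, rels r -> forall t, foldr act t r = t.

Lemma word_act_pres_eq u v : pres_eq rels u v ->
  forall t, foldr act t u = foldr act t v.
Proof.
elim=> {u v} [u t|u v _ uv t|u v w _ uv _ vw t|u a v t|u r v rr t] //.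
- by rewrite uv vw.
- by rewrite !foldr_cat /= actK.
- by rewrite !foldr_cat (act_rels rr).
Qed.

Definition pres_act (x : G) (t : T) : T := foldr act t (repr x).

Lemma pres_act_pi w t : pres_act (\pi_G w) t = foldr act t w.
Proof. by apply: word_act_pres_eq; apply/pi_presP; rewrite reprK. Qed.

Lemma pres_act1 t : pres_act 1%g t = t.
Proof. by rewrite -pres_pi_nil pres_act_pi. Qed.

Lemma pres_actM x y t : pres_act (x * y)%g t = pres_act x (pres_act y t).
Proof.
by rewrite -[x]reprK -[y]reprK -pres_pi_cat !pres_act_pi foldr_cat.
Qed.

Lemma pres_actK x : cancel (pres_act x) (pres_act x^-1%g).
Proof. by move=> t; rewrite -pres_actM mulVg pres_act1. Qed.

Lemma pres_actVK x : cancel (pres_act x^-1%g) (pres_act x).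
Proof. by move=> t; rewrite -pres_actM mulgV pres_act1. Qed.

End PresentedGroupAction.

(** * The projection of the extension onto the surface group, and its kernel *)

Section SurfaceExtension.
Local Open Scope quotient_scope.
Context (g : nat).
Local Notation gen := ('I_g + 'I_g)%type.
Notation G := (surface_group g).
Notation E := (surface_ext_group g).
Notation piG := (\pi_(presented_group (@surface_relators g))).
Notation piE := (\pi_(presented_group (@surface_ext_relators g))).

Definition lift_word (w : word gen) : word (option gen) :=
  [seq (Some a.1, a.2) | a <- w].

Lemma lift_surface_word :
  lift_word (surface_word inl inr) = surface_word (Some \o inl) (Some \o inr).
Proof.
by rewrite /lift_word /surface_word map_flatten -map_comp.
Qed.

(** An action of the letters on the surface group in which [z] is trivial; it respects the relators,
    and the projection is then the orbit map of the identity. *)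
Definition ext_left (a : option gen * bool) (h : G) : G :=
  if a.1 is Some s then (piG [:: (s, a.2)] * h)%g else h.

Lemma ext_leftK a : cancel (ext_left (letter_inv a)) (ext_left a).
Proof.
case: a => [[s|] b] h; rewrite /ext_left //= mulgA -pres_pi_cat.
rewrite (_ : piG _ = 1%g) ?mul1g//.
by apply/pi_presP; exact: (pres_eq_cancel _ [::] (s, b) [::]).
Qed.

Lemma ext_left_lift w h : foldr ext_left h (lift_word w) = (piG w * h)%g.
Proof.
elim: w h => [|[s b] w IH] h; first by rewrite pres_pi_nil mul1g.
by rewrite /= IH /ext_left /= mulgA -pres_pi_cat.
Qed.

Lemma ext_left_rels r : surface_ext_relators r ->
  forall h, foldr ext_left h r = h.
Proof.
move=> [->|[s _ <-]] h.
  rewrite -lift_surface_word foldr_cat /= {2}/ext_left /= ext_left_lift.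
  rewrite (_ : piG _ = 1%g) ?mul1g//.
  apply/pi_presP; have := @pres_eq_relator _ (@surface_relators g) [::] _ [::].
  by move=> /(_ (surface_word inl inr)); rewrite /= cats0; apply.
exact: (ext_leftK (Some s, false)).
Qed.

Definition ext_proj (x : E) : G := pres_act ext_left x 1%g.

Lemma ext_proj_pi w h : foldr ext_left h w = (foldr ext_left 1 w * h)%g.
Proof.
elim: w => [|[[s|] b] w IH] /=; rewrite ?mul1g//.
by rewrite IH /ext_left /= mulgA.
Qed.

Lemma ext_projM x y : ext_proj (x * y)%g = (ext_proj x * ext_proj y)%g.
Proof.
rewrite /ext_proj (pres_actM ext_leftK ext_left_rels).
by rewrite {1}/pres_act ext_proj_pi.
Qed.

Lemma ext_proj1 : ext_proj 1%g = 1%g.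
Proof. by rewrite /ext_proj (pres_act1 ext_leftK ext_left_rels). Qed.

Lemma ext_projV x : ext_proj x^-1%g = (ext_proj x)^-1%g.
Proof.
by apply: (mulgI (ext_proj x)); rewrite -ext_projM !mulgV ext_proj1.
Qed.

Definition ext_center : E := piE [:: (None, false)].

Lemma ext_proj_center : ext_proj ext_center = 1%g.
Proof. by rewrite /ext_proj (pres_act_pi ext_leftK ext_left_rels). Qed.

Lemma ext_proj_lift w : ext_proj (piE (lift_word w)) = piG w.
Proof.
by rewrite /ext_proj (pres_act_pi ext_leftK ext_left_rels) ext_left_lift mulg1.
Qed.

Lemma ext_proj_surj h : exists x, ext_proj x = h.
Proof. by exists (piE (lift_word (repr h))); rewrite ext_proj_lift reprK. Qed.

(** The relators give commutation of [z] with the [x_i] and [y_i]; this extends to their inverses,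
    and to words by induction. *)
Lemma ext_center_commute x : commute ext_center x.
Proof.
rewrite -[x]reprK; elim: (repr x) => [|[s b] w IH]; first exact: commute1.
rewrite -[_ :: w]/([:: (s, b)] ++ w) pres_pi_cat; apply: commuteM IH.
suff h : commute ext_center (piE [:: (s, false)]).
  by case: b => //; rewrite pres_pi_invl; exact: commuteV.
case: s => [s|]; last exact: commute_refl.
have : piE (commutator_word None (Some s)) = 1%g.
  apply/pi_presP; have := @pres_eq_relator _ (@surface_ext_relators g) [::] _ [::].
  move=> /(_ (commutator_word None (Some s))); rewrite cats0; apply.
  by right; exists s.
rewrite -[commutator_word _ _]/([:: (None, false)] ++ [:: (Some s, false)] ++
  [:: (None, true)] ++ [:: (Some s, true)]).
rewrite !pres_pi_cat !pres_pi_invl -/ext_center => h.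
set s' := piE _ in h *.
apply: (@mulIg _ (ext_center^-1 * s'^-1)%g).
by rewrite -!mulgA h mulVKg mulgV.
Qed.

(** A pair of natural exponents in place of an integer keeps products and inverses free of case
    distinctions on the sign. *)
Definition central_power (x : E) : Prop :=
  exists m n : nat, x = (ext_center ^+ m * (ext_center ^+ n)^-1)%g.

Lemma central_power_commute x y : central_power x -> commute x y.
Proof.
have cX m : commute y (ext_center ^+ m)%g.
  exact/commuteX/commute_sym/ext_center_commute.
move=> [m [n ->]]; apply/commute_sym/commuteM; first exact: cX.
exact/commuteV/cX.
Qed.

Lemma central_power1 : central_power 1%g.
Proof. by exists 0%N, 0%N; rewrite mulgV. Qed.

Lemma central_powerV x : central_power x -> central_power x^-1%g.
Proof. by move=> [m [n ->]]; exists n, m; rewrite invgM invgK. Qed.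

Lemma central_powerM x y :
  central_power x -> central_power y -> central_power (x * y)%g.
Proof.
move=> [m [n ->]] [k [l ->]]; exists (m + k)%N, (l + n)%N.
rewrite !expgnDr invgM -!mulgA; congr (_ * _)%g; rewrite !mulgA; congr (_ * _)%g.
apply/commute_sym/commuteV; apply: commuteX2; exact: commute_refl.
Qed.

Lemma central_power_center : central_power ext_center.
Proof. by exists 1%N, 0%N; rewrite invg1 mulg1. Qed.

Lemma central_power_conj x y : central_power x -> (y * x / y)%g = x.
Proof. by move=> /(central_power_commute y) <-; rewrite mulgK. Qed.

(** Every elementary move on words is lifted: a cancellation remains one, and an inserted relator
    [R] lifts to [z], which is central and therefore survives conjugation by the surrounding
    word. *)
Lemma central_power_lift u v : pres_eq (@surface_relators g) u v ->
  central_power (piE (lift_word u) / piE (lift_word v))%g.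
Proof.
elim=> {u v} [u|u v _ uv|u v w _ uv _ vw|u a v|u r v ->].
- by rewrite mulgV; exact: central_power1.
- by have := central_powerV uv; rewrite invgM invgK.
- by have := central_powerM uv vw; rewrite mulgA mulgVK.
- suff -> : piE (lift_word (u ++ [:: a; letter_inv a] ++ v)) =
      piE (lift_word (u ++ v)) by rewrite mulgV; exact: central_power1.
  apply/pi_presP; rewrite /lift_word !map_cat.
  exact: (@pres_eq_cancel _ _ _ (Some a.1, a.2)).
- rewrite /lift_word !map_cat -!/(lift_word _) !pres_pi_cat.
  have -> : piE (lift_word (surface_word inl inr)) = ext_center.
    apply: (@mulIg _ (ext_center^-1)%g); rewrite mulgV -pres_pi_invl -pres_pi_cat.
    apply/pi_presP.
    have := @pres_eq_relator _ (@surface_ext_relators g) [::] _ [::].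
    move=> /(_ (surface_word (Some \o inl) (Some \o inr) ++ [:: (None, true)])).
    by rewrite cats0 lift_surface_word; apply; left.
  rewrite invgM !mulgA mulgK central_power_conj; exact: central_power_center.
Qed.

(** Central letters can be pulled out of a word, which leaves the lift of a word in the surface
    generators. *)
Lemma ext_decomposition x : exists w, central_power (x / piE (lift_word w))%g.
Proof.
rewrite -[x]reprK; elim: (repr x) => [|[s b] w [w' IH]].
  by exists [::]; rewrite mulgV; exact: central_power1.
rewrite -[_ :: w]/([:: (s, b)] ++ w) pres_pi_cat.
case: s => [s|].
  exists ((s, b) :: w').
  rewrite -[lift_word _]/([:: (Some s, b)] ++ lift_word w') pres_pi_cat.
  rewrite invgM mulgA -(mulgA (piE [:: _])) central_power_conj; exact: IH.
exists w'; rewrite -mulgA; apply: central_powerM IH.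
case: b; last exact: central_power_center.
rewrite pres_pi_invl; exact/central_powerV/central_power_center.
Qed.

Lemma ext_proj_central_power x : central_power x -> ext_proj x = 1%g.
Proof.
have pX m : ext_proj (ext_center ^+ m)%g = 1%g.
  elim: m => [|m IH]; first exact: ext_proj1.
  by rewrite expgS ext_projM IH ext_proj_center mulg1.
by move=> [m [n ->]]; rewrite ext_projM ext_projV !pX invg1 mulg1.
Qed.

(** Write [x] as a central power times the lift of a word [w]. Central powers project to 1, so [w]
    is trivial in the surface group, and its lift is itself a central power. *)
Lemma ext_proj_ker x : ext_proj x = 1%g -> central_power x.
Proof.
move=> x1; have [w xw] := ext_decomposition x.
have := ext_proj_central_power xw.
rewrite ext_projM ext_projV ext_proj_lift x1 mul1g => /eqP.
rewrite invg_eq1 => /eqP; rewrite -pres_pi_nil => /pi_presP /central_power_lift wn.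
have := central_powerM xw wn; rewrite mulgA mulgVK.
by rewrite /= pres_pi_nil invg1 mulg1.
Qed.

End SurfaceExtension.

(** * The measure space: the line times a discrete group *)

Section SliceSpace.
Context (R : realType) (D : groupType).
Local Open Scope classical_set_scope.

(** A separate name for the product, to carry a sigma-algebra and a measure defined slice by slice:
    the measure is Lebesgue measure times counting measure on [D]. *)
Definition slices : Type := (R * D)%type.

HB.instance Definition _ := Choice.copy slices (R * D)%type.
HB.instance Definition _ := isPointed.Build slices (0, 1%g).

Definition slice (A : set slices) (h : D) : set R := [set t | A (t, h)].

Definition slice_measurable (A : set slices) : Prop :=
  forall h, measurable (slice A h).

Lemma slice_measurable0 : slice_measurable set0.
Proof. by move=> h; exact: measurable0. Qed.

Lemma slice_measurableC A : slice_measurable A -> slice_measurable (~` A).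
Proof. by move=> mA h; exact: measurableC (mA h). Qed.

Lemma slice_bigcup (F : (set slices)^nat) h :
  slice (\bigcup_i F i) h = \bigcup_i slice (F i) h.
Proof. by []. Qed.

Lemma slice_measurable_bigcup (F : (set slices)^nat) :
  (forall i, slice_measurable (F i)) -> slice_measurable (\bigcup_i F i).
Proof.
move=> mF h; rewrite slice_bigcup; apply: bigcupT_measurable => i.
exact: mF.
Qed.

HB.instance Definition _ := @isMeasurable.Build default_measure_display slices
  slice_measurable slice_measurable0 slice_measurableC slice_measurable_bigcup.

Definition slice_measure (A : set slices) : \bar R :=
  \esum_(h in [set: D]) lebesgue_measure (slice A h).

Lemma slice_measure0 : slice_measure set0 = 0%E.
Proof. by apply: esum1 => h _; exact: measure0. Qed.

Lemma slice_measure_ge0 A : (0 <= slice_measure A)%E.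
Proof. by apply: esum_ge0 => h _; exact: measure_ge0. Qed.

(** Both sides are double sums of nonnegative terms, over [D] and over the sequence; they are
    exchanged by viewing each as one sum over pairs. *)
Lemma slice_measure_sigma_additive : semi_sigma_additive slice_measure.
Proof.
move=> F mF tF mUF.
suff -> : slice_measure (\bigcup_n F n) =
    (\sum_(0 <= n <oo) slice_measure (F n))%E.
  by apply: is_cvg_nneseries => n _ _; exact: slice_measure_ge0.
rewrite nneseries_esumT; last by move=> n; exact: slice_measure_ge0.
rewrite /slice_measure.
transitivity (\esum_(h in [set: D]) \esum_(n in [set: nat])
    lebesgue_measure (slice (F n) h)).
  apply: eq_esum => h _; rewrite slice_bigcup measure_bigcup//; last 2 first.
  - by move=> n _; exact: mF.
  - move=> i j _ _ [t [Ft Ft']]; apply: (tF i j I I).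
    by exists (t, h).
  rewrite -nneseries_esumT => [|n]; last exact: measure_ge0.
  by apply: eq_eseriesl => n; rewrite in_setT.
rewrite !esum_esum; [|by move=> *; exact: measure_ge0..].
rewrite (reindex_esum ([set: nat] `*`` fun=> [set: D]) _ (fun x => (x.2, x.1)))//.
split=> //.
- by move=> [n h] [h' n'] _ _ [-> ->].
- by move=> [h n] _; exists (n, h).
Qed.

HB.instance Definition _ := isMeasure.Build _ _ _ slice_measure
  slice_measure0 slice_measure_ge0 slice_measure_sigma_additive.

Lemma slice_measure_single (A : set R) (h : D) :
  slice_measure [set x | A x.1 /\ x.2 = h] = lebesgue_measure A.
Proof.
rewrite /slice_measure (esumID [set h]); last by move=> *; exact: measure_ge0.
rewrite setTI esum_set1; last exact: measure_ge0.
rewrite esum1 ?adde0 => [|k [_ /= kh]].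
  by congr lebesgue_measure; apply/seteqP; split=> t //= [].
rewrite (_ : slice _ _ = set0) ?measure0//.
by apply/seteqP; split=> t //= [_ /kh].
Qed.

Lemma measurable_single (A : set R) (h : D) :
  measurable A -> measurable ([set x | A x.1 /\ x.2 = h] : set slices).
Proof.
move=> mA.
suff : slice_measurable [set x | A x.1 /\ x.2 = h] by [].
move=> k; have [->|kh] := eqVneq k h.
  by rewrite (_ : slice _ _ = A)//; apply/seteqP; split=> t //= [].
rewrite (_ : slice _ _ = set0) ?measurable0//.
by apply/seteqP; split=> t //= [_ /eqP]; rewrite (negPf kh).
Qed.

(** The map [f] preserves the measure of each slice, and the bijection [s] permutes the slices. *)
Lemma slice_measure_product_map (f : R -> R) (s s' : D -> D) :
  measurable_fun setT f ->
  (forall A, measurable A -> lebesgue_measure (f @^-1` A) = lebesgue_measure A) ->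
  cancel s s' -> cancel s' s ->
  let F := (fun x : slices => (f x.1, s x.2) : slices) in
  measurable_fun setT F /\
  forall A, measurable A -> slice_measure (F @^-1` A) = slice_measure A.
Proof.
move=> mf pf sK s'K F; split=> [_ A mA|A mA].
  suff : slice_measurable (F @^-1` A) by rewrite setTI.
  move=> h; rewrite (_ : slice _ _ = f @^-1` slice A (s h))//.
  by rewrite -[_ @^-1` _]setTI; exact: mf (mA _).
rewrite /slice_measure [RHS](reindex_esum setT setT s)//; last first.
  split=> //; first by move=> x y _ _ /(can_inj sK).
  by move=> x _; exists (s' x).
by apply: eq_esum => h _; rewrite -[RHS]pf//; exact: mA.
Qed.

(** The enumeration [e] makes [D] countable; the cells [(m, m + 1] x {e k}] have measure 1 and are
    indexed by codes of the pairs [(m, k)]. *)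
Lemma slice_measure_sigma_finite (e : nat -> D) : (forall h, exists n, e n = h) ->
  sigma_finite setT slice_measure.
Proof.
move=> esurj.
pose J (m : int) : set R := [set t | lint t = m].
have mJ m : measurable (J m).
  rewrite (_ : J m = `]m%:~R, m%:~R + 1])//.
  by apply/seteqP; split=> t; rewrite /= in_itv /= lintE => /eqP.
pose F n : set slices := if pickle_inv n is Some (m, k)
  then [set x | J m x.1 /\ x.2 = e k] else set0.
exists F.
  apply/esym/seteqP; split=> // -[t h] _; have [k kh] := esurj h.
  exists (pickle (lint t, k)); first exact: I.
  rewrite /F pickleK_inv; split; [reflexivity|exact/esym].
move=> n; rewrite /F; case: (pickle_inv n) => [[m k]|]; last first.
  by rewrite measure0; split => //; exact: measurable0.
split; first exact: measurable_single.
rewrite slice_measure_single (_ : J m = `]m%:~R, m%:~R + 1]); last first.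
  by apply/seteqP; split=> t; rewrite /= in_itv /= lintE => /eqP.
by rewrite lebesgue_measure_itv /= lte_fin ltrDl ltr01 -EFinB ltry.
Qed.

End SliceSpace.

(** * Integrability of powers of weak [L^1] functions *)

Section WeakL1.
Context d (T : measurableType d) (R : realType).
Variable mu : {measure set T -> \bar R}.
Local Open Scope classical_set_scope.

Lemma nneseries_geometric_lty (a q : R) : 0 <= q < 1 ->
  (\sum_(0 <= k <oo) (a * q ^+ k)%:E < +oo)%E.
Proof.
move=> /andP[q0 q1].
have nq : `|q| < 1 by rewrite ger0_norm.
rewrite (_ : (fun _ => _) = EFin \o series (geometric a q)).
  by rewrite EFin_lim ?ltry//; exact: is_cvg_geometric_series.
by apply/funext => n; rewrite /= sumEFin.
Qed.

(** Where [2^k <= h < 2^(k+1)], the power [h^p] is at most [(2^p)^(k+1)], so [h^p] is dominated by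
    the sum over [k] of these constants times the indicators of [h >= 2^k]. By the tail bound the
    [k]-th integral is at most [2^p C (2^p / 2)^k], and the ratio is less than 1 because [p < 1]. *)
Lemma weak_L1_integrable_power (D : set T) (h : T -> nat) (C p : R) :
  measurable D -> (forall n, measurable (D `&` [set x | (n <= h x)%N])) ->
  0 < p < 1 ->
  (forall n, (0 < n)%N ->
     (mu (D `&` [set x | (n <= h x)%N]) <= (C / n%:R)%:E)%E) ->
  (\int[mu]_(x in D) ((h x)%:R `^ p)%:E < +oo)%E.
Proof.
move=> mD mh /andP[p0 p1] hC.
pose B k := D `&` [set x | (2 ^ k <= h x)%N].
pose c k : R := (2 `^ p) ^+ k.+1.
have c0 k : 0 <= c k by rewrite exprn_ge0 ?powR_ge0.
pose F k x : \bar R := ((c k)%:E * (\1_(B k) x)%:E)%E.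
have F0 k x : (0 <= F k x)%E by rewrite /F mule_ge0 ?lee_fin.
have mF k : measurable_fun D (F k).
  apply: emeasurable_funM => //; apply/measurable_EFinP.
  by apply: measurable_indic; exact: mh.
have mhp : measurable_fun D (fun x => ((h x)%:R `^ p)%:E).
  apply/measurable_EFinP.
  have mhn : measurable_fun D h.
    move=> mD' A mA; rewrite (_ : _ `&` _ = \bigcup_(n in A)
        ((D `&` [set x | (n <= h x)%N]) `\` (D `&` [set x | (n < h x)%N]))).
      by apply: bigcup_measurable => n _; apply: measurableD; exact: mh.
    apply/seteqP; split=> [x [Dx Ahx]|x [n An [[Dx /= nh] hn]]].
      by exists (h x) => //; split => //= -[_]; rewrite ltnn.
    split=> //=; suff -> : h x = n by [].
    by apply/eqP; rewrite eqn_leq nh andbT leqNgt; apply/negP => ?; exact: hn.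
  exact: (@measurableT_comp _ _ _ _ _ _ (fun n : nat => n%:R `^ p)).
apply: (@le_lt_trans _ _ (\int[mu]_(x in D) \sum_(0 <= k <oo) F k x)%E).
  apply: ge0_le_integral => //.
  - by apply: ge0_emeasurable_sum => // k x _ _; exact: F0.
  - move=> x Dx; have [h0|h0] := posnP (h x).
      by rewrite h0 powR0 ?gt_eqF//; exact: nneseries_ge0.
    have /andP[lo hi] := trunc_log_bounds (isT : (1 < 2)%N) h0.
    set k := trunc_log 2 (h x) in lo hi.
    apply: (@le_trans _ _ (F k x)).
      rewrite /F indicE mem_set ?mule1; last by split.
      rewrite lee_fin /c -powR_mulrn ?powR_ge0// -powRrM mulrC powRrM.
      rewrite powR_mulrn// ge0_ler_powR ?nnegrE ?ler0n ?exprn_ge0 ?(ltW p0)//.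
      by rewrite ltW// -natrX ltr_nat.
    apply: le_trans (nneseries_lim_ge k.+1 _) => //.
    by rewrite big_nat_recr//= leeDr//; apply: sume_ge0.
rewrite integral_nneseries//.
have FE k : (\int[mu]_(x in D) F k x = (c k)%:E * mu (B k))%E.
  rewrite ge0_integralZl//; last 2 first.
  - by apply/measurable_EFinP/measurable_indic; exact: mh.
  - by rewrite lee_fin.
  by rewrite integral_indic//; [rewrite /B setIAC setIid|exact: mh].
pose q : R := 2 `^ p / 2.
apply: (@le_lt_trans _ _ (\sum_(0 <= k <oo) ((2 `^ p * C) * q ^+ k)%:E)%E).
  apply: lee_nneseries => k _; first by rewrite integral_ge0.
  rewrite FE; apply: le_trans (lee_wpmul2l _ (hC _ _)) _.
  - by rewrite lee_fin.
  - by rewrite expn_gt0.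
  by rewrite -EFinM lee_fin /c /q natrX exprS expr_div_n; lra.
apply: nneseries_geometric_lty; rewrite divr_ge0 ?powR_ge0//=.
(* The ratio is below 1 because [exp (p ln 2) < exp (ln 2)]. *)
rewrite ltr_pdivrMr// mul1r /powR pnatr_eq0 /= -[ltRHS]lnK ?posrE//.
by rewrite ltr_expR gtr_pMl// ln_gt0// ltr1n.
Qed.

End WeakL1.

(** * Word lengths of products and integer powers *)

Section WordLength.
Context (G : groupType) (S : set G).
Hypothesis hS : finite_generating_set S.

(** Since [S] generates the group, the default value of [xget] is never taken and the length is an
    attained minimum. *)
Lemma word_lengthP x : is_word_length_of S x (word_length S x) /\
  forall m, is_word_length_of S x m -> (word_length S x <= m)%N.
Proof.
rewrite /word_length; case: xgetP => [n _ //|nP].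
have [n0 n0P] := hS.2 x.
have h : exists n, `[< is_word_length_of S x n >] by exists n0; apply/asboolP.
case: (ex_minnP h) => n /asboolP nx nmin.
by case: (nP n); split=> // m mx; apply: nmin; apply/asboolP.
Qed.

Lemma word_length1 : word_length S 1%g = 0%N.
Proof.
apply/eqP; rewrite -leqn0; apply: (word_lengthP _).2.
by exists [::]; split=> //; rewrite big_nil.
Qed.

Lemma word_lengthM x y :
  (word_length S (x * y)%g <= word_length S x + word_length S y)%N.
Proof.
have [[u [<- uS <-]] _] := word_lengthP x.
have [[v [<- vS <-]] _] := word_lengthP y.
apply: (word_lengthP _).2; exists (u ++ v); split; first exact: size_cat.
  by move=> s; rewrite mem_cat => /orP[/uS|/vS].
by rewrite big_cat.
Qed.

Lemma word_lengthX x n : (word_length S (x ^+ n)%g <= n * word_length S x)%N.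
Proof.
elim: n => [|n IH]; first by rewrite word_length1.
by rewrite expgS mulSn (leq_trans (word_lengthM _ _))// leq_add2l.
Qed.

End WordLength.

Section IntegerPowers.
Context (G : groupType).

Definition expgz (x : G) (k : int) : G :=
  match k with Posz n => (x ^+ n)%g | Negz n => (x^-1 ^+ n.+1)%g end.

Lemma word_length_expgz (S : set G) (hS : finite_generating_set S) x k :
  (word_length S (expgz x k) <=
   `|k| * maxn (word_length S x) (word_length S x^-1%g))%N.
Proof.
by case: k => n /=; rewrite (leq_trans (word_lengthX hS _ _))// leq_mul2l
  ?NegzE ?abszN /= ?leq_maxl ?leq_maxr ?orbT.
Qed.

End IntegerPowers.

(** * The action of the generators on the line *)

Section SurfaceAction.
Context {R : realType} {g : nat}.
Local Open Scope quotient_scope.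
Local Notation gen := ('I_g + 'I_g)%type.
Notation G := (surface_group g).
Notation E := (surface_ext_group g).

(* [x_0] and [x_1] act as the inverses of the exchanges, so that [x_i, y_i] acts
   as [t |-> t + (a (phi t) - a t)], see [commutator_exch_shear]. *)
Definition letter_map (a : option gen * bool) : R -> R :=
  match a.1 with
  | None => fun x => x + (if a.2 then -1 else 1 : int)%:~R
  | Some (inl i) => if (i < 2)%N then
      periodize ((if a.2 then exch else exch_inv) (i == 0%N :> nat)) else idfun
  | Some (inr i) => if (i < 2)%N then shear (if a.2 then -1 else 1) else idfun
  end.

Lemma letter_mapK a : cancel (letter_map (letter_inv a)) (letter_map a).
Proof.
case: a => [[[i|i]|] b]; rewrite /letter_map /=.
- case: ifP => // _; case: b => /=; apply: periodizeK.
  + exact: exch_inv_itv.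
  + exact: exch_invK.
  + exact: exch_itv.
  + exact: exchK.
- case: ifP => // _; case: b => /=; last by exact: (@shearK R (-1)).
  exact: (@shearK R 1).
- by move=> x; case: b; rewrite -addrA -intrD ?subrr ?addNr addr0.
Qed.

(** The three properties together pass to composites, hence from letters to all words; weak
    integrability of a composite relies on the other two. *)
Definition tame_map (f : R -> R) : Prop :=
  [/\ piecewise_translation f, unit_preserving f & weakly_integrable_shift f].

Lemma tame_map_shift (k : int) : `|k|%:~R <= 1 :> R ->
  tame_map (fun x => x + k%:~R).
Proof.
move=> k1.
have mk : measurable_fun setT (fun x : R => x + k%:~R).
  by apply: measurable_funD => //; exact: measurable_cst.
split.
- split=> // [x m|x]; first by rewrite addrAC.
  by rewrite addrAC subrr add0r; exact: rational_real_int.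
- by apply: unit_preserving_shift => x; exists k.
- apply: weakly_integrable_shift_bounded => // x _.
  by rewrite addrAC subrr add0r -intr_norm.
Qed.

Lemma tame_map_id : tame_map idfun.
Proof.
have := @tame_map_shift 0; rewrite normr0 ler01 => /(_ isT).
by rewrite (_ : (fun _ => _) = idfun)//; apply/funext => x /=; rewrite addr0.
Qed.

Lemma tame_map_comp f f' : tame_map f -> tame_map f' -> tame_map (f \o f').
Proof.
move=> [pf uf wf] [pf' uf' wf']; split.
- exact: piecewise_translation_comp.
- exact: unit_preserving_comp.
- exact: weakly_integrable_shift_comp.
Qed.

Lemma tame_map_periodize (f f' : R -> R) :
  piecewise_translation (periodize f) -> piecewise_translation (periodize f') ->
  (forall r, 0 < r <= 1 -> 0 < f r <= 1) ->
  (forall r, 0 < r <= 1 -> 0 < f' r <= 1) ->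
  (forall r, 0 < r <= 1 -> f' (f r) = r) ->
  (forall r, 0 < r <= 1 -> f (f' r) = r) ->
  tame_map (periodize f).
Proof.
move=> pf pf' fI f'I fK f'K; split=> //.
  by apply: (unit_preserving_periodize pf pf').
apply: weakly_integrable_shift_bounded => [x x0|]; last by have [] := pf.
have := fI _ x0; rewrite /periodize lint_unit// add0r rfrac_unit// ler_norml; lra.
Qed.

Lemma tame_letter_map a : tame_map (letter_map a).
Proof.
case: a => [[[i|i]|] b]; rewrite /letter_map /=.
- case: ifP => _; last exact: tame_map_id.
  case: b.
    apply: tame_map_periodize (piecewise_translation_exch _)
      (piecewise_translation_exch_inv _) _ _ _ _.
    + exact: exch_itv.
    + exact: exch_inv_itv.
    + exact: exchK.
    + exact: exch_invK.
  apply: tame_map_periodize (piecewise_translation_exch_inv _)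
    (piecewise_translation_exch _) _ _ _ _.
  + exact: exch_inv_itv.
  + exact: exch_itv.
  + exact: exch_invK.
  + exact: exchK.
- case: ifP => _; last exact: tame_map_id.
  split; first exact: piecewise_translation_shear.
    by apply: unit_preserving_shift => x; exact: shear_shift.
  by apply: weakly_integrable_shear; case: b.
- by apply: tame_map_shift; case: b.
Qed.

Lemma tame_word (w : word (option gen)) :
  tame_map (fun x => foldr letter_map x w).
Proof.
elim: w => [|a w IH]; first exact: tame_map_id.
exact: tame_map_comp (tame_letter_map a) IH.
Qed.

End SurfaceAction.

(** * The relators act trivially on the line *)

Section SurfaceActionRelators.
Context {R : realType}.

(** Only the commutators of index 0 and 1 act nontrivially. Their displacements are the two terms of
    [height_exch], which add up to 1. *)
Lemma surface_word_map (g : nat) (hg : (2 <= g)%N) (x : R) :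
  foldr letter_map x
    (surface_word (Some \o inl) (Some \o inr) :
      word (option ('I_g + 'I_g)%type)) = x + 1.
Proof.
have id_tail (s : seq 'I_g) y : (forall i, i \in s -> (2 <= i)%N) ->
  foldr letter_map y (flatten [seq commutator_word
    (((Some \o inl) i) : option ('I_g + 'I_g)) ((Some \o inr) i) | i <- s])
  = y :> R.
  elim: s => // i s IH s2; rewrite /= IH => [|j js]; last first.
    by apply: s2; rewrite in_cons js orbT.
  have := s2 i (mem_head _ _); rewrite leqNgt => /negPf i2.
  by rewrite /letter_map /= i2.
have comm (i : 'I_g) (y : R) : (i < 2)%N -> foldr letter_map y (commutator_word
    (((Some \o inl) i) : option ('I_g + 'I_g)) ((Some \o inr) i)) =
    y + (height (exch (i == 0%N :> nat) (rfrac y)) - height (rfrac y)).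
  by move=> i2; rewrite -commutator_exch_shear /= /letter_map /= i2.
have [i0 [i1 [s [sE i0E i1E s2]]]] : exists (i0 i1 : 'I_g) s,
    [/\ enum 'I_g = i0 :: i1 :: s, i0 = 0%N :> nat, i1 = 1%N :> nat &
    forall i, i \in s -> (2 <= i)%N].
  case: g hg {id_tail comm} => [//|[//|n]] _.
  rewrite enum_ordSl enum_ordSl map_cons -map_comp.
  exists ord0, (lift ord0 ord0), [seq (lift ord0 \o lift ord0) i | i <- enum 'I_n].
  by split=> // i /mapP[j _ ->].
rewrite /surface_word sE !map_cons.
rewrite -[flatten _]/(commutator_word _ _ ++ (commutator_word _ _ ++ flatten _)).
rewrite !foldr_cat id_tail// (comm i1) ?i1E// (comm i0) ?i0E// eqxx /=.
have x0 := rfrac_itv x; have [n hn] := height_int x0.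
have [k hk] := height_int (exch_itv false x0).
(* [foldr] applies the commutator of index 1 first; its displacement is an integer, so the one of
   index 0 sees the same fractional part. *)
rewrite [in rfrac (_ + _)]hk [in rfrac (_ + _)]hn -intrB rfracDr.
by rewrite -[in RHS](height_exch x0); lra.
Qed.

Lemma letter_map_rels (g : nat) (hg : (2 <= g)%N) r :
  surface_ext_relators r -> forall x : R, foldr (@letter_map R g) x r = x.
Proof.
move=> [->|[s _ <-]] x.
  by rewrite foldr_cat surface_word_map//= /letter_map /= -addrA addNr addr0.
(* The relator [[z, s]] acts trivially because every letter commutes with integer translations. *)
transitivity (letter_map (Some s, false)
    (letter_map (Some s, true) x + (-1)%:~R) + 1%:~R); first by [].
have [[_ sD _] _ _] := @tame_letter_map R g (Some s, false).
have sK := letter_mapK (Some s, false) x.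
by rewrite sD sK -addrA -intrD addNr addr0.
Qed.

End SurfaceActionRelators.

(** * The coupling and the integrability of its cocycles *)

Section Coupling.
Context {R : realType} {g : nat} (hg : (2 <= g)%N).
Local Open Scope classical_set_scope.
Local Open Scope quotient_scope.
Notation G := (surface_group g).
Notation E := (surface_ext_group g).
Notation L := (surface_group g * infinite_cyclic_group)%type.
Notation X := (slices R G).
Notation I := (@unit_itv R).

Definition line_act (x : E) : R -> R := pres_act (@letter_map R g) x.

Lemma line_act1 t : line_act 1%g t = t.
Proof. exact: (pres_act1 letter_mapK (letter_map_rels hg)). Qed.

Lemma line_actM x y t : line_act (x * y)%g t = line_act x (line_act y t).
Proof. exact: (pres_actM letter_mapK (letter_map_rels hg)). Qed.

Lemma line_actK x : cancel (line_act x) (line_act x^-1%g).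
Proof. exact: (pres_actK letter_mapK (letter_map_rels hg)). Qed.

Lemma line_actVK x : cancel (line_act x^-1%g) (line_act x).
Proof. exact: (pres_actVK letter_mapK (letter_map_rels hg)). Qed.

Lemma tame_line_act x : tame_map (line_act x).
Proof. exact: tame_word. Qed.

Lemma line_actDr x t (m : int) : line_act x (t + m%:~R) = line_act x t + m%:~R.
Proof. by have [[_ h _] _ _] := tame_line_act x; exact: h. Qed.

Lemma line_act_preserves x (A : set R) : measurable A ->
  lebesgue_measure (line_act x @^-1` A) = lebesgue_measure A.
Proof.
have [p _ _] := tame_line_act x; have [p' _ _] := tame_line_act x^-1%g.
exact: piecewise_translation_preserves p p' (line_actK x) (line_actVK x) A.
Qed.

Lemma line_act_center t : line_act (@ext_center g) t = t + 1.
Proof. by rewrite /line_act (pres_act_pi letter_mapK (letter_map_rels hg)). Qed.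

Lemma line_act_centerX n t : line_act (@ext_center g ^+ n)%g t = t + n%:R.
Proof.
elim: n t => [|n IH] t; first by rewrite line_act1 addr0.
by rewrite expgS line_actM IH line_act_center -addrA -natr1.
Qed.

Lemma line_act_centerXV n t :
  line_act (@ext_center g ^+ n)^-1%g t = t - n%:R.
Proof.
apply: (can_inj (line_actK (@ext_center g ^+ n)%g)).
by rewrite line_actVK line_act_centerX subrK.
Qed.

Lemma line_act_expgz k t : line_act (expgz (@ext_center g) k) t = t + k%:~R.
Proof.
case: k => n /=; first by rewrite line_act_centerX.
by rewrite expVgn line_act_centerXV NegzE intrN.
Qed.

Lemma ext_proj_expgz k : ext_proj (expgz (@ext_center g) k) = 1%g.
Proof.
apply: ext_proj_central_power; case: k => n /=.
  by exists n, 0%N; rewrite invg1 mulg1.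
by exists 0%N, n.+1; rewrite mul1g expVgn.
Qed.

(** A power of [z] acts as an integer translation. One that carries a point of [(0, 1]] into
    [(0, 1]] is by 0, which forces the two exponents to agree. *)
Lemma central_power_free x t t' : central_power x -> I t -> I t' ->
  line_act x t = t' -> x = 1%g.
Proof.
move=> [m [n ->]]; rewrite !unit_itvE => tI t'I.
rewrite line_actM line_act_centerXV line_act_centerX => tt'.
have /eqP : lint (t + (m%:Z - n%:Z)%:~R) = lint t'.
  by congr lint; rewrite -tt' intrB -!pmulrn; lra.
rewrite lintDr !lint_unit// add0r subr_eq0 => /eqP[->].
by rewrite mulgV.
Qed.

Definition ext_act (x : E) (p : X) : X :=
  (line_act x p.1, (ext_proj x * p.2)%g).

Definition prod_act (l : L) (p : X) : X :=
  (p.1 + (l.2 : int)%:~R, (p.2 * l.1^-1)%g).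

Definition base : set X := [set p | I p.1 /\ p.2 = 1%g].

Lemma measurable_base : measurable base.
Proof. by apply: measurable_single; exact: measurable_unit_itv. Qed.

Lemma slice_measure_base : slice_measure base = 1%E.
Proof. by rewrite slice_measure_single lebesgue_unit_itv. Qed.

Lemma ext_act_mp : measure_preserving_action (@slice_measure R G) ext_act.
Proof.
have h x := @slice_measure_product_map R G (line_act x) (fun h => ext_proj x * h)%g
  (fun h => (ext_proj x)^-1 * h)%g
  (let: And3 (And3 m _ _) _ _ := tame_line_act x in m)
  (@line_act_preserves x) (mulKg (ext_proj x)) (mulVKg (ext_proj x)).
split; first split.
- by move=> [t k]; rewrite /ext_act /= line_act1 ext_proj1 mul1g.
- by move=> x y [t k]; rewrite /ext_act /= line_actM ext_projM mulgA.
- by move=> x; have [] := h x.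
- by move=> x; have [] := h x.
Qed.

Lemma prod_act_mp : measure_preserving_action (@slice_measure R G) prod_act.
Proof.
have mt (m : int) : measurable_fun setT (fun t : R => t + m%:~R).
  by apply: measurable_funD => //; exact: measurable_cst.
have h (l : L) := @slice_measure_product_map R G (fun t => t + (l.2 : int)%:~R)
  (fun h => h * l.1^-1)%g (fun h => h * l.1)%g (mt _)
  (@lebesgue_measure_translation R (l.2 : int)%:~R) (mulgVK l.1) (mulgK l.1).
split; first split.
- by move=> [t k]; rewrite /prod_act /= addr0 invg1 mulg1.
- move=> [l m] [l' m'] [t k]; rewrite /prod_act /=; congr pair.
    by rewrite -addrA -intrD (addrC m').
  by rewrite invgM mulgA.
- by move=> l; have [] := h l.
- by move=> l; have [] := h l.
Qed.

(** The group coordinate shows that [y^-1 x] projects to 1 and so is a power of [z]; the line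
    coordinate then shows that it is trivial. *)
Lemma ext_act_base_inj x y p q : base p -> base q ->
  ext_act x p = ext_act y q -> x = y.
Proof.
move: p q => [t k] [t' k'] [/= tI ->] [/= t'I ->] [tt' xy].
have yx : (y^-1 * x)%g = 1%g.
  apply: (@central_power_free _ t t') => //.
    apply: ext_proj_ker; rewrite ext_projM ext_projV.
    by move: xy; rewrite !mulg1 => ->; rewrite mulVg.
  by rewrite line_actM tt' line_actK.
by rewrite -[x](mulVKg y) yx mulg1.
Qed.

(** A lift of the inverse of the group coordinate brings that coordinate to 1; a power of [z], which
    leaves it fixed, then brings the line coordinate into [(0, 1]]. *)
Lemma ext_act_base_cover p : exists x, base (ext_act x p).
Proof.
case: p => t h; have [x xh] := ext_proj_surj h^-1%g.
exists (expgz (@ext_center g) (- lint (line_act x t)) * x)%g => //.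
split=> /=; last by rewrite ext_projM ext_proj_expgz mul1g xh mulVg.
rewrite line_actM line_act_expgz unit_itvE intrN; exact: rfrac_itv.
Qed.

Lemma prod_act_base_inj l l' p q : base p -> base q ->
  prod_act l p = prod_act l' q -> l = l'.
Proof.
move: p q l l' => [t k] [t' k'] [l m] [l' m'] [/= tI ->] [/= t'I ->] [/= tt' ll'].
move: tI t'I; rewrite !unit_itvE => tI t'I.
congr pair; last first.
  by have := congr1 lint tt'; rewrite !lintDr !lint_unit// !add0r.
by move: ll'; rewrite !mul1g => /invg_inj.
Qed.

Lemma fundamental_domain_base (H : groupType) (a : H -> X -> X) :
  is_group_action a ->
  (forall x y p q, base p -> base q -> a x p = a y q -> x = y) ->
  (forall p, exists x, base (a x p)) ->
  fundamental_domain (@slice_measure R G) a base.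
Proof.
move=> [a1 aM] inj cover; split; first exact: measurable_base.
- move=> x y xy; rewrite (_ : _ `&` _ = set0); first exact: negligible_set0.
  apply/seteqP; split=> // _ [[p bp <-] [q bq pq]]; apply: xy.
  by apply: inj bp bq _.
- rewrite (_ : ~` _ = set0); first exact: negligible_set0.
  apply/seteqP; split=> // p; apply; have [x bx] := cover p.
  exists x^-1%g => //; exists (a x p) => //.
  by rewrite -aM mulVg a1.
Qed.

Lemma prod_act_base_cover p : exists l, base (prod_act l p).
Proof.
case: p => t h; exists (h, - lint t : infinite_cyclic_group) => //.
split; last exact: mulgV.
by rewrite /= unit_itvE intrN; exact: rfrac_itv.
Qed.

Lemma measurable_lint_pred (F : R -> R) (P : int -> Prop) :
  measurable_fun setT F -> measurable [set t | P (lint (F t))].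
Proof.
move=> mF; rewrite (_ : mkset _ =
    (fun t => (lint (F t))%:~R : R) @^-1` [set k%:~R | k in P]).
  rewrite -[_ @^-1` _]setTI.
  have mlF := measurableT_comp measurable_lint mF.
  apply: mlF => //; apply: countable_measurable => //.
  by apply: card_le_trans (card_image_le _ _) _; exact: countableP.
apply/seteqP; split=> t /= => [Pt|[k Pk /eqP]]; first by exists (lint (F t)).
by rewrite eqr_int => /eqP <-.
Qed.

(** Here [N] is a word length as a function of an integer. It grows at most affinely, and
    [lint (F t)] is within 1 of the displacement [F t - t] on [(0, 1]], so [H] inherits the weak
    [L^1] tail of that displacement. *)
Lemma tame_map_integrable_power (F : R -> R) (N : int -> nat) (a b : nat)
    (H : X -> nat) (p : R) :
  tame_map F -> (forall k, (N k <= a + b * `|k|)%N) ->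
  (forall x, base x -> H x = N (lint (F x.1))) -> 0 < p < 1 ->
  (\int[@slice_measure R G]_(x in base) ((H x)%:R `^ p)%:E < +oo)%E.
Proof.
move=> [[mF _ _] _ [C hC]] hN hH hp.
pose A n : set R := I `&` [set t | (n <= N (lint (F t)))%N].
have mA n : measurable (A n).
  apply: measurableI; first exact: measurable_unit_itv.
  exact: (measurable_lint_pred (fun k => (n <= N k)%N)).
have AE n : base `&` [set x | (n <= H x)%N] = [set x | A n x.1 /\ x.2 = 1%g].
  apply/seteqP; split=> [x [bx /= nH]|x /= [[Ix nN] x1]].
    by rewrite hH// in nH; case: bx => Ix x1.
  have bx : base x by [].
  by split=> //=; rewrite hH.
have C0 : 0 <= C.
  have := le_trans (measure_ge0 _ _) (hC 1 ltr01).
  by rewrite divr1 lee_fin.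
pose s : R := (a + b).+1%:R.
have s0 : 0 < s by rewrite ltr0n.
apply: (@weak_L1_integrable_power _ _ _ _ _ _ (2 * s * (C + 1))) => //.
- exact: measurable_base.
- by move=> n; rewrite AE; exact: measurable_single.
move=> n n0; rewrite AE -[leLHS]/(slice_measure _) slice_measure_single.
have nR0 : 0 < n%:R :> R by rewrite ltr0n.
(* For [n < 2 s] the total mass 1 already suffices. Otherwise [n <= s (1 + |F t - t|)] absorbs the
   summand [s] into [n / 2] and gives [|F t - t| >= n / (2 s)]. *)
have [ns|ns] := ltP n%:R (2 * s).
  apply: (@le_trans _ _ (lebesgue_measure I)).
    apply: le_measure; rewrite ?inE; [exact: mA|exact: measurable_unit_itv|].
    by move=> t [].
  rewrite lebesgue_unit_itv lee_fin ler_pdivlMr// mul1r.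
  rewrite (le_trans (ltW ns))// ler_peMr ?lerDr//.
  by rewrite mulr_ge0 ?ltW.
have r0 : 0 < n%:R / (2 * s) by rewrite divr_gt0 ?mulr_gt0.
apply: le_trans (le_trans _ (hC _ r0)) _.
  apply: le_measure; rewrite ?inE; first exact: mA.
    apply: measurableI; first exact: measurable_unit_itv.
    exact: measurable_shift_ge.
  move=> t [It /= nN]; split=> //=.
  have := leq_trans nN (hN _); rewrite -(ler_nat R) natrD natrM.
  rewrite natr_absz intr_norm => nab.
  have tl : `|(lint (F t))%:~R| <= 1 + `|F t - t|.
    have := rfrac_itv (F t); rewrite /rfrac; move: It; rewrite unit_itvE => It h.
    have : `|(lint (F t))%:~R - (F t - t)| <= 1 by rewrite ler_norml; lra.
    have := ler_normD ((lint (F t))%:~R - (F t - t)) (F t - t).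
    by rewrite subrK; lra.
  rewrite ler_pdivrMr ?mulr_gt0//.
  have ab : a%:R + b%:R * `|(lint (F t))%:~R| <= s * (1 + `|F t - t|).
    rewrite /s -natr1 natrD.
    have a0 : 0 <= a%:R :> R by [].
    have b0 : 0 <= b%:R :> R by [].
    have := ler_wpM2l b0 tl; have := normr_ge0 (F t - t) => n1.
    have := mulr_ge0 a0 n1; nra.
  nra.
rewrite lee_fin (_ : C / _ = 2 * s * C / n%:R); last first.
  by field; rewrite !gt_eqF.
by rewrite ler_pM2r ?invr_gt0// ler_wpM2l ?lerDl// mulr_ge0// ltW.
Qed.

Lemma slice_measure_sigma_finite_surface :
  sigma_finite setT (@slice_measure R G).
Proof.
(* The group is countable as a quotient of the set of words; a number that codes no word is sent to
   the identity. *)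
apply: (@slice_measure_sigma_finite _ _ (fun n =>
  \pi_(presented_group (@surface_relators g))
    (odflt [::] (unpickle n : option (seq (('I_g + 'I_g) * bool)))))) => h.
by exists (pickle (repr h : seq (('I_g + 'I_g) * bool))); rewrite pickleK /= reprK.
Qed.

Lemma slice_measure_neq0 : @slice_measure R G setT <> 0%E.
Proof.
move=> m0; have : (slice_measure base <= @slice_measure R G setT)%E.
  by apply: le_measure; rewrite ?inE//; exact: measurable_base.
by rewrite m0 slice_measure_base lee_fin ler10.
Qed.

Lemma ext_act_prod_act x l p :
  ext_act x (prod_act l p) = prod_act l (ext_act x p).
Proof.
by case: p => t h; rewrite /ext_act /prod_act /= line_actDr mulgA.
Qed.

Lemma ext_act_domain : fundamental_domain (@slice_measure R G) ext_act base.
Proof.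
apply: fundamental_domain_base; last exact: ext_act_base_cover.
  by have [] := ext_act_mp.
by move=> x y p q; exact: ext_act_base_inj.
Qed.

Lemma prod_act_domain : fundamental_domain (@slice_measure R G) prod_act base.
Proof.
apply: fundamental_domain_base; last exact: prod_act_base_cover.
  by have [] := prod_act_mp.
by move=> l l' p q; exact: prod_act_base_inj.
Qed.

Lemma slice_measure_base_lty : (@slice_measure R G base < +oo)%E.
Proof. by rewrite slice_measure_base ltry. Qed.

Definition surface_coupling : ME_coupling R E L :=
  @MECoupling R E L _ X (@slice_measure R G) ext_act prod_act base base
    slice_measure_sigma_finite_surface slice_measure_neq0 ext_act_mp prod_act_mp
    ext_act_prod_act ext_act_domain prod_act_domain
    slice_measure_base_lty slice_measure_base_lty.

(** Translates of [base] are disjoint without exceptional points, so the set from which [xget]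
    chooses has exactly one element. *)
Lemma coupling_cocycle_base (H K : groupType) (a : H -> X -> X) (b : K -> X -> X)
    h k x : is_group_action b ->
  (forall k k' p q, base p -> base q -> b k p = b k' q -> k = k') ->
  base (b k (a h x)) -> coupling_cocycle a b base h x = k.
Proof.
move=> [b1 bM] inj bk; apply: xget_subset1 => // k1 k2 /= bk1 bk2.
apply: (can_inj invgK); apply: inj bk1 bk2 _.
by rewrite -!bM !mulVg.
Qed.

Lemma alphaE x p : base p -> coupling_cocycle ext_act prod_act base x p =
  (ext_proj x, - lint (line_act x p.1) : infinite_cyclic_group).
Proof.
move=> [pI p1]; apply: coupling_cocycle_base.
- by have [] := prod_act_mp.
- by move=> l l' ? ?; exact: prod_act_base_inj.
- split; last by rewrite /= p1 mulg1 mulgV.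
  by rewrite /= unit_itvE intrN; exact: rfrac_itv.
Qed.

Lemma betaE (l : L) x p : ext_proj x = l.1 -> base p ->
  coupling_cocycle prod_act ext_act base l p =
  (expgz (@ext_center g) (- (lint (line_act x p.1) + l.2)) * x)%g.
Proof.
move=> xl [pI p1]; apply: coupling_cocycle_base.
- by have [] := ext_act_mp.
- by move=> y y' ? ?; exact: ext_act_base_inj.
- split; last first.
    by rewrite /= p1 ext_projM ext_proj_expgz mul1g xl mul1g mulgV.
  rewrite /= line_actM line_act_expgz line_actDr unit_itvE intrN intrD.
  rewrite opprD addrACA subrr addr0; exact: rfrac_itv.
Qed.

Lemma expgz_unit (k : int) : expgz ((1%g, (1 : int)) : L) k = (1%g, k) :> L.
Proof.
have eX (c : int) n : (((1%g, c) : L) ^+ n)%g = (1%g, c *+ n) :> L.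
  elim: n => [//|n IH]; rewrite expgS IH mulrS.
  by congr pair; exact: mul1g.
have e : ((1%g, (1 : int)) : L)^-1%g = (1%g, (-1 : int)) :> L.
  by congr (_, _); exact: invg1.
case: k => n; rewrite /expgz.
  by apply: etrans (eX 1 n) _; rewrite natz.
apply: etrans (congr1 (fun u : L => u ^+ n.+1)%g e) _.
by apply: etrans (eX (-1) n.+1) _; rewrite mulNrn natz NegzE.
Qed.

Lemma surface_coupling_in_Lp (S : set E) (S' : set L) (p : R) :
  finite_generating_set S -> finite_generating_set S' -> 0 < p < 1 ->
  in_Lp S S' surface_coupling p.
Proof.
move=> hS hS' hp; split=> [x|[l m]].
  pose N (k : int) := word_length S' ((ext_proj x, - k : infinite_cyclic_group) : L).
  pose u : L := (1%g, (1 : int)).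
  apply: (@tame_map_integrable_power (line_act x) N
    (word_length S' ((ext_proj x, 1%g) : L))
    (maxn (word_length S' u) (word_length S' u^-1%g))) => //.
  - exact: tame_line_act.
  - move=> k; rewrite /N mulnC -abszN.
    (* A fixed element times the power [-k] of the cyclic generator has length at most affine in the
       absolute value of [k]. *)
    have -> : ((ext_proj x, - k : infinite_cyclic_group) : L) =
        ((ext_proj x, 1%g) * expgz u (- k))%g.
      rewrite expgz_unit; congr pair; first exact/esym/mulg1.
      exact/esym/(@mul1g infinite_cyclic_group).
    apply: leq_trans (word_lengthM hS' _ _) _; rewrite leq_add2l.
    exact: word_length_expgz.
  - by move=> y yb; rewrite /me_alpha alphaE.
(* One lift [x] of [l] serves for all points, so the cocycle depends on the point only through an
   integer part. *)
have [x xl] := ext_proj_surj l.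
pose N (k : int) := word_length S (expgz (@ext_center g) (- (k + m)) * x)%g.
pose b := maxn (word_length S (@ext_center g)) (word_length S (@ext_center g)^-1%g).
apply: (@tame_map_integrable_power (line_act x) N
  (`|m| * b + word_length S x) b) => //.
- exact: tame_line_act.
- move=> k; rewrite /N.
  apply: leq_trans (word_lengthM hS _ _) _; rewrite addnAC leq_add2r.
  apply: leq_trans (word_length_expgz hS _ _) _.
  rewrite abszN (mulnC b) -mulnDl leq_mul2r addnC; apply/orP; right; lia.
- by move=> y yb; rewrite /me_beta (@betaE (l, m) x).
Qed.

End Coupling.

Unset Implicit Arguments.

Theorem theorem1p3 (R : realType) (g : nat) (hg : (2 <= g)%N)
    (S : set (surface_ext_group g))
    (S' : set (surface_group g * infinite_cyclic_group)%type)
    (hS : finite_generating_set S) (hS' : finite_generating_set S') :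
  exists X : ME_coupling R (surface_ext_group g) (surface_group g * infinite_cyclic_group)%type,
    forall p : R, 0 < p < 1 -> in_Lp S S' X p.
Proof.
exists (surface_coupling hg) => p hp.
exact: surface_coupling_in_Lp.
Qed.
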